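(* For every non-negative integer $n$ there exist integers $x,y,z,t$ with $$P_8(x)+P_8(y)+3P_8(z)+6P_8(t)=n,$$ where $P_8(x)=3x^2-2x$. That is, the sum $\Phi_{1,1,3,6}$ of generalized octagonal numbers is universal over $\mathbb{Z}$.
   Context: A generalized octagonal number is an integer of the form $P_8(x)=3x^2-2x$ with $x\in\mathbb{Z}$. For positive integers $a_1,\dots,a_k$, $\Phi_{a_1,\dots,a_k}(x_1,\dots,x_k)=a_1P_8(x_1)+\cdots+a_kP_8(x_k)$; it is called universal over $\mathbb{Z}$ if the equation $\Phi_{a_1,\dots,a_k}(x_1,\dots,x_k)=n$ has an integer solution for every non-negative integer $n$. *)

(* Defs.v *)
From Stdlib Require Import ZArith List.
Import ListNotations.
Open Scope Z_scope.

Definition P8 (x : Z) : Z := 3 * x ^ 2 - 2 * x.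

(* [combine] truncates to the shorter list, so [Phi a x] is the intended sum
   a_1 P8(x_1) + ... + a_k P8(x_k) only when the two lists have equal length. *)
Definition Phi (a : list positive) (x : list Z) : Z :=
  fold_right Z.add 0 (map (fun '(ai, xi) => Zpos ai * P8 xi) (combine a x)).

Definition universal (a : list positive) : Prop :=
  forall n : Z, 0 <= n -> exists x : list Z, length x = length a /\ Phi a x = n.

(* Main.v *)
(* Since 3 P8(x) + 1 = (3x - 1)^2, one has to write N = 3n + 11 as
   X^2 + Y^2 + 3 Z^2 + 6 T^2 with X, Y, Z, T prime to 3.  Choose v in {1, 2} such that
   N - 18 v^2 is 1 or 2 modulo 4; then it is a sum of three squares x^2 + y^2 + z^2, and as
   N = 2 mod 3 exactly one of them, say z = 3u, is divisible by 3.  Finally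
   9 u^2 + 18 v^2 = 3 (Z^2 + 2 T^2) with (Z, T) = (u + 2v, u - v) or (u - 2v, u + v).

   Three squares: a squarefree n = 1, 2 mod 4 is represented by a positive ternary form of
   determinant 1, hence is a sum of three squares, as soon as some m prime to n satisfies
   "-n is a square mod m and -m is a square mod n".  Instead of taking m prime by Dirichlet's
   theorem, let chi be the character with chi(q) = (-n/q) and A = 1 * chi, and compare
   sums of order R = sqrt X: by the hyperbola method
     sum_{m <= X} A(m) prod_{p | n} (1 + (-1/p)(m/p)) = sum_{m <= X} A(m) + O(R),
   while sum_{m <= X} A(m) exceeds every multiple of R, because A >= 1 on the values
   x^2 + n y^2 prime to 2n.  So some term is nonzero, and the squarefree part of that m
   works. *)
Require Import Defs.
From Stdlib Require Import ZArith List Lia.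
Import ListNotations.
Open Scope Z_scope.

(** * Ternary forms of determinant 1 *)

Lemma centered_shift (a d : Z) : 0 < a -> exists k : Z, - a <= 2 * (d + k * a) <= a.
Proof.
intros Ha; exists (- ((2 * d + a) / (2 * a))).
pose proof (Z.div_mod (2 * d + a) (2 * a) ltac:(lia)).
pose proof (Z.mod_pos_bound (2 * d + a) (2 * a) ltac:(lia)).
nia.
Qed.

(** Lagrange-Gauss reduction by descent on [A]: while 3 A^2 > 4 D, centering [B] modulo [A] gives A
    C' = D + B'^2 < 3 A^2/4 + A^2/4, so C' < A and the neighbouring form (C', -B', A) takes over. *)
Lemma binary_form_reduction (A B C D : Z) :
  0 < A -> 0 < D -> A * C - B * B = D ->
  exists p q r s : Z, p * s - q * r = 1 /\
    0 < A * p * p + 2 * B * p * r + C * r * r /\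
    3 * (A * p * p + 2 * B * p * r + C * r * r) ^ 2 <= 4 * D.
Proof.
revert B C; induction A as [A IH] using (well_founded_induction (Z.lt_wf 0)).
intros B C HA HD HE.
destruct (Z_le_gt_dec (3 * A ^ 2) (4 * D)) as [Hle|Hgt].
  exists 1, 0, 0, 1.
  replace (A * 1 * 1 + 2 * B * 1 * 0 + C * 0 * 0) with A by ring; lia.
destruct (centered_shift A B HA) as [k Hk].
set (B' := B + k * A) in *; set (C' := A * k * k + 2 * B * k + C).
assert (E' : A * C' - B' * B' = D) by (unfold B', C'; rewrite <- HE; ring).
assert (HB : 4 * (B' * B') <= A * A) by nia.
assert (HC : 0 < C' < A) by nia.
destruct (IH C' ltac:(lia) (- B') A ltac:(lia) HD ltac:(lia))
  as (p & q & r & s & H1 & H2 & H3).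
(* The substitution of the induction hypothesis, multiplied on the left by the matrix with rows (k,
   -1) and (1, 0), which turns (A, B, C) into (C', -B', A). *)
exists (k * p - r), (k * q - s), p, q.
replace (A * (k * p - r) * (k * p - r) + 2 * B * (k * p - r) * p + C * p * p)
  with (C' * p * p + 2 * - B' * p * r + A * r * r) by (unfold B', C'; ring).
split; [rewrite <- H1; ring | now split].
Qed.

Lemma half_square (a d : Z) : - a <= 2 * d <= a -> 4 * (d * d) <= a * a.
Proof. nia. Qed.

(* Hermite's bound, which makes the reduction below terminate. *)
Lemma hermite_step (a A b d : Z) :
  1 < a -> 0 < A -> 3 * A ^ 2 <= 4 * a -> a * b = A + d * d -> 4 * (d * d) <= a * a ->
  0 < b < a.
Proof.
intros Ha HA Hb E Hd; split; [nia|].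
destruct (Z_lt_le_dec b a) as [|Hge]; [assumption|exfalso].
assert (H1 : a * a <= a * b) by nia.
assert (H2 : 3 * (a * a) <= 4 * A) by lia.
assert (H3 : 3 * a <= 2 * A) by nia.
clear - Ha Hb H3; nia.
Qed.

(** The quadratic form of the symmetric matrix with rows (a, d, e), (d, b, g), (e, g, c). *)
Definition ternary (a b c d e g x y z : Z) : Z :=
  a * x * x + b * y * y + c * z * z + 2 * d * x * y + 2 * e * x * z + 2 * g * y * z.

(** Descent on [a] among positive definite matrices of determinant 1. Only the values of the form
    are followed, so no substitution matrix has to be carried along. *)
Theorem unimodular_ternary_three_squares (a b c d e g : Z) :
  0 < a -> 0 < a * b - d * d ->
  a * b * c + 2 * d * e * g - a * g * g - b * e * e - c * d * d = 1 ->
  forall x y z : Z, exists u v w : Z, ternary a b c d e g x y z = u * u + v * v + w * w.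
Proof.
revert b c d e g; induction a as [a IH] using (well_founded_induction (Z.lt_wf 0)).
intros b c d e g Ha HA Hdet x y z.
(* [A, B, C] is the form in (y, z) left after completing the square in x; once it is
   reduced and 2|d| <= a, exchanging x and y decreases the leading coefficient. *)
set (A := a * b - d * d) in *; set (B := a * g - d * e); set (C := a * c - e * e).
assert (HD : A * C - B * B = a).
{ transitivity (a * 1); [rewrite <- Hdet; unfold A, B, C; ring | ring]. }
destruct (binary_form_reduction A B C a HA Ha HD) as (p & q & r & s & Hu & Hp & Hr).
set (y' := s * y - q * z); set (z' := p * z - r * y).
assert (Ey : y = p * y' + q * z').
{ transitivity ((p * s - q * r) * y); [rewrite Hu | unfold y', z']; ring. }
assert (Ez : z = r * y' + s * z').
{ transitivity ((p * s - q * r) * z); [rewrite Hu | unfold y', z']; ring. }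
set (A' := A * p * p + 2 * B * p * r + C * r * r) in *.
set (b1 := b * p * p + 2 * g * p * r + c * r * r).
set (c1 := b * q * q + 2 * g * q * s + c * s * s).
set (g1 := b * p * q + g * (p * s + q * r) + c * r * s).
set (d1 := d * p + e * r); set (e1 := d * q + e * s).
assert (EA1 : a * b1 - d1 * d1 = A') by (unfold b1, d1, A', A, B, C; ring).
assert (Hdet1 : a * b1 * c1 + 2 * d1 * e1 * g1 - a * g1 * g1 - b1 * e1 * e1 - c1 * d1 * d1 = 1).
{ transitivity ((p * s - q * r) ^ 2 *
    (a * b * c + 2 * d * e * g - a * g * g - b * e * e - c * d * d)).
  - unfold b1, c1, d1, e1, g1; ring.
  - rewrite Hu, Hdet; reflexivity. }
assert (Et : ternary a b c d e g x y z = ternary a b1 c1 d1 e1 g1 x y' z').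
{ rewrite Ey, Ez; unfold ternary, b1, c1, d1, e1, g1; ring. }
rewrite Et; clear Et Ey Ez.
clearbody y' z' A' b1 c1 d1 e1 g1.
destruct (Z.eq_dec a 1) as [E1|Hne].
(* For a = 1 the bound 3 A'^2 <= 4 a forces A' = 1; completing two squares then leaves z'^2 with
   coefficient 1, the determinant. *)
- clearbody A B C; clear HD; subst a. assert (EA' : A' = 1) by nia.
  set (w := g1 - d1 * e1).
  exists (x + d1 * y' + e1 * z'), (y' + w * z'), z'.
  assert (Eb : b1 = 1 + d1 * d1) by lia.
  assert (Ec : c1 = 1 + w * w + e1 * e1) by (unfold w; rewrite Eb in Hdet1; lia).
  unfold ternary; rewrite Eb, Ec; unfold w; ring.
- destruct (centered_shift a d1 Ha) as [k Hk].
  set (d2 := d1 + k * a) in *.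
  set (b2 := a * k * k + 2 * d1 * k + b1); set (g2 := g1 + k * e1).
  assert (E2 : a * b2 = A' + d2 * d2) by (rewrite <- EA1; unfold b2, d2; ring).
  assert (Hd2 := half_square a d2 Hk).
  assert (Hb2 := hermite_step a A' b2 d2 ltac:(lia) Hp Hr E2 Hd2).
  destruct (IH b2 ltac:(lia) a c1 d2 g2 e1 ltac:(lia) ltac:(lia)
              ltac:(rewrite <- Hdet1; unfold b2, d2, g2; ring) y' (x - k * y') z')
    as (u & v & w & Huvw).
  exists u, v, w; rewrite <- Huvw; unfold ternary, b2, d2, g2; ring.
Qed.

(** A form taking the value n at (1, 0, 0) is built backwards: completing the square in its first
    variable must leave (m, b, c), of determinant n. With rows (n, s, u), (s, t, b'), (u, b', c')
    this asks for n b' = b + s u and n c' = c + u^2. *)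
Lemma three_squares_of_congruences (n m b c s t i j : Z) :
  0 < n -> 0 < m -> m * c = b * b + n -> s * s + m = n * t -> i * m + j * n = 1 ->
  exists x y z : Z, n = x * x + y * y + z * z.
Proof.
intros Hn Hm Hc Ht Hij.
(* Modulo n one has i m = 1, s^2 = -m and b^2 = m c, whence s u = -b and u^2 = -c. *)
set (u := s * b * i).
assert (Hb : exists b', n * b' = b + s * u).
{ exists (b * j + t * b * i). unfold u.
  replace (b + s * (s * b * i)) with (b * 1 + (s * s) * b * i) by ring.
  rewrite <- Hij. replace (s * s) with (n * t - m) by lia. ring. }
destruct Hb as [b' Hb].
assert (Hc' : exists c', n * c' = c + u * u).
{ exists (t * (m * c - n) * i * i + m * i * i + c * j * (1 + i * m)). unfold u.
  replace (s * b * i * (s * b * i)) with ((s * s) * (b * b) * i * i) by ring.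
  replace (s * s) with (n * t - m) by lia. replace (b * b) with (m * c - n) by lia.
  assert (Hj : j * n = 1 - i * m) by lia.
  transitivity (n * (t * (m * c - n) * i * i + m * i * i) + c * (j * n) * (1 + i * m)); [ring|].
  rewrite Hj; ring. }
destruct Hc' as [c' Hc'].
assert (Ha : n * t = m + s * s) by lia.
destruct (unimodular_ternary_three_squares n t c' s u b') with (x := 1) (y := 0) (z := 0)
  as (x & y & z & H).
- assumption.
- rewrite Ha; lia.
- apply (Z.mul_reg_l _ _ n); [lia|].
  transitivity ((n * t) * (n * c') - (n * t) * (u * u) - (s * s) * (n * c') - (n * b') * (n * b') + 2 * (s * u) * (n * b')).
  + ring.
  + rewrite Ha, Hb, Hc'. lia.
- exists x, y, z. rewrite <- H. unfold ternary. ring.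
Qed.

From mathcomp Require Import all_boot all_order all_algebra finfield zify ring.

Set Implicit Arguments.
Unset Strict Implicit.
Unset Printing Implicit Defensive.
Import Order.TTheory GRing.Theory Num.Theory.

(** * Quadratic reciprocity *)

Section Reciprocity.
Local Open Scope ring_scope.

(* The Legendre symbol (d/p), by Euler's criterion; only meaningful for an odd prime [p]. *)
Definition leg (p d : nat) : int :=
  let a : 'F_p := d%:R in
  if a == 0 then 0 else if a ^+ p./2 == 1 then 1 else -1.

Section OddPrime.
Variables (p : nat).
Hypotheses (pr_p : prime p) (odd_p : odd p).
Local Notation h := (p./2).
Local Notation F := 'F_p.

Lemma odd_primeE : p = h.*2.+1.
Proof. by rewrite -[LHS]odd_double_half odd_p. Qed.

Lemma half_prime_gt0 : (0 < h)%N.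
Proof. have := prime_gt1 pr_p; have := odd_primeE; lia. Qed.

Lemma natF_eq i j : (i%:R == j%:R :> F) = (i == j %[mod p]).
Proof. by rewrite -val_eqE /= !val_Fp_nat. Qed.

Lemma natF_eq0 i : (i%:R == 0 :> F) = (p %| i)%N.
Proof. by rewrite (dvdn_pcharf (pchar_Fp pr_p)). Qed.

Lemma natF_inj i j : (i < p)%N -> (j < p)%N -> i%:R = j%:R :> F -> i = j.
Proof. by move=> ip jp /eqP; rewrite natF_eq !modn_small // => /eqP. Qed.

Lemma one_neqN1_F : (1 != -1 :> F).
Proof.
rewrite -addr_eq0 -[1 + 1]/(2%:R) natF_eq0; apply/negP => /dvdn_leq.
by have := odd_primeE; have := half_prime_gt0; lia.
Qed.

Lemma expF_half (a : F) : a != 0 -> a ^+ h = 1 \/ a ^+ h = -1.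
Proof.
move=> a0; have : a ^+ h.*2 = 1.
  apply: (mulfI a0); rewrite -exprS -odd_primeE mulr1.
  by have := expf_card a; rewrite card_Fp.
rewrite -muln2 exprM => /eqP; rewrite -subr_eq0 subr_sqr_1 mulf_eq0 subr_eq0 addr_eq0.
by case/orP => /eqP; [left | right].
Qed.

Lemma legE a : (leg p a)%:~R = a%:R ^+ h :> F.
Proof.
rewrite /leg; case: eqP => [->|/eqP a0].
  by rewrite expr0n eqn0Ngt half_prime_gt0.
case: eqP => [->//|ne1]; case: (expF_half a0) => // ->; by rewrite rmorphN1.
Qed.

Definition signs : seq int := [:: 0; 1; -1].

Lemma leg_signs a : leg p a \in signs.
Proof. by rewrite /leg /signs; case: ifP => // _; case: ifP. Qed.

(** Since 0, 1 and -1 stay distinct modulo an odd prime, identities between signs can be checked in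
    the field, where [leg] is the power of exponent h. *)
Lemma signs_inj (x y : int) : x \in signs -> y \in signs ->
  x%:~R = y%:~R :> F -> x = y.
Proof.
have n1 := one_neqN1_F; have n0 : (1 != 0 :> F) := oner_neq0 _.
have N0 : (-1 != 0 :> F) by rewrite oppr_eq0.
rewrite !inE => /or3P[]/eqP-> /or3P[]/eqP-> //=; rewrite ?rmorphN1 ?rmorph0 ?rmorph1 => /eqP.
all: by rewrite ?(eq_sym 0) ?(eq_sym (-1) 1) ?(negbTE n1) ?(negbTE n0) ?(negbTE N0).
Qed.

Lemma legM a b : leg p (a * b) = leg p a * leg p b.
Proof.
apply: signs_inj; rewrite ?leg_signs //.
  have := leg_signs a; have := leg_signs b.
  by rewrite !inE => /or3P[]/eqP-> /or3P[]/eqP->.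
by rewrite rmorphM /= !legE natrM exprMn.
Qed.

Lemma leg1 : leg p 1 = 1.
Proof. by apply: signs_inj; rewrite ?leg_signs ?legE ?expr1n. Qed.

Lemma leg_mod a b : a = b %[mod p] -> leg p a = leg p b.
Proof. by move/eqP; rewrite -natF_eq /leg => /eqP->. Qed.

Lemma leg_eq0 a : (leg p a == 0) = (p %| a)%N.
Proof. by rewrite -natF_eq0 /leg; case: ifP => //; case: ifP. Qed.

Lemma leg_pm1 a : ~~ (p %| a)%N -> leg p a = 1 \/ leg p a = -1.
Proof.
rewrite -leg_eq0; have := leg_signs a; rewrite !inE.
by case/or3P => /eqP -> //; [left | right].
Qed.

Lemma leg_opp : leg p p.-1 = (-1) ^+ h.
Proof.
apply: signs_inj; rewrite ?leg_signs // ?legE; first by rewrite -signr_odd; case: odd.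
rewrite rmorphXn /= rmorphN1; congr (_ ^+ _); apply/eqP.
by rewrite -addr_eq0 -[1]/(1%:R) -natrD addn1 prednK ?prime_gt0 // natF_eq0.
Qed.

Lemma small_pm i j : (0 < i <= h)%N -> (0 < j <= h)%N ->
  i%:R = j%:R :> F \/ i%:R = - j%:R :> F -> i = j.
Proof.
have := odd_primeE => pE /andP[i0 ih] /andP[j0 jh] [/natF_inj|/eqP]; first by apply; lia.
rewrite -addr_eq0 -natrD natF_eq0 => /dvdn_leq; lia.
Qed.

(** The squares of 1, ..., h are h distinct roots of X^h - 1; a further root [a] would be one too
    many. *)
Lemma leg1_sqr a : leg p a = 1 -> exists x, x * x = a %[mod p].
Proof.
move=> la; pose s := [seq (i%:R ^+ 2 : F) | i <- iota 1 h].
have us : uniq s.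
  rewrite map_inj_in_uniq ?iota_uniq // => i j; rewrite !mem_iota => ip jp /eqP.
  rewrite eqf_sqr => /orP E; apply: small_pm; try lia.
  by case: E => /eqP; [left | right].
have sn0 : all (fun x => x != 0) s.
  apply/allP => x /mapP[i]; rewrite mem_iota => ip ->; rewrite sqrf_eq0 natF_eq0.
  by apply/negP => /dvdn_leq; have := odd_primeE; lia.
have rs : all (root ('X^h - 1%:P)) s.
  apply/allP => x xs; move: (allP sn0 _ xs) => x0; case/mapP: xs x0 => i _ -> i0.
  rewrite rootE !hornerE -exprM mulnC exprM.
  have : (i%:R : F) != 0 by apply: contraNneq i0 => ->; rewrite expr0n.
  by case/expF_half => ->; rewrite ?sqrrN expr1n subrr.
have [as_|nas] := boolP ((a%:R : F) \in s).
  case/mapP: as_ => i _ /eqP; rewrite -natrX natF_eq eq_sym => /eqP E.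
  by exists i; rewrite -E.
have := @max_poly_roots _ ('X^h - 1%:P : {poly F}) ((a%:R : F) :: s).
rewrite -size_poly_eq0 size_XnsubC ?half_prime_gt0 //= rs us nas /= size_map size_iota.
rewrite rootE !hornerE -legE la subrr eqxx /= => /(_ isT isT isT); by rewrite ltnn.
Qed.

(** Otherwise all p - 1 = 2h nonzero classes would be roots of X^h - 1. *)
Lemma nonresidue : exists2 g, leg p g = -1 & (0 < g < p)%N.
Proof.
have [/allP al|] := boolP (all (fun i => leg p i == 1) (iota 1 h.*2)); last first.
  case/allPn => g; rewrite mem_iota => gp l1; exists g; last by have := odd_primeE; lia.
  have : ~~ (p %| g)%N by apply/negP => /dvdn_leq; have := odd_primeE; lia.
  by case/leg_pm1 => // E; rewrite E in l1.
pose s := [seq (i%:R : F) | i <- iota 1 h.*2].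
have us : uniq s.
  rewrite map_inj_in_uniq ?iota_uniq // => i j; rewrite !mem_iota => ip jp.
  by apply: natF_inj; have := odd_primeE; lia.
have rs : all (root ('X^h - 1%:P)) s.
  apply/allP => _ /mapP[i /al /eqP li ->].
  by rewrite rootE !hornerE -legE li subrr.
have := @max_poly_roots _ ('X^h - 1%:P : {poly F}) s.
rewrite -size_poly_eq0 size_XnsubC ?half_prime_gt0 //= size_map size_iota.
by move=> /(_ isT rs us); have := half_prime_gt0; lia.
Qed.

(** * Gauss's lemma *)

Section Gauss.
Variable a : nat.
Hypothesis pa : ~~ (p %| a)%N.

Let r x := ((a * x) %% p)%N.
(** The absolute value of the absolutely least residue of a x modulo p. *)
Let s x := (if (r x <= h)%N then r x else p - r x)%N.

Lemma gauss_range x : (0 < x <= h)%N -> (0 < s x <= h)%N.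
Proof.
move=> xh; have r0 : (0 < r x)%N.
  rewrite lt0n -/(dvdn p (a * x)) Euclid_dvdM // (negbTE pa) /=.
  by apply/negP => /dvdn_leq; have := odd_primeE; lia.
have : (r x < p)%N by rewrite ltn_mod prime_gt0.
by rewrite /s; case: ifP => E; have := odd_primeE; lia.
Qed.

Lemma gauss_sign x : (a * x)%:R = (-1) ^+ (h < r x)%N * (s x)%:R :> F.
Proof.
have E : (a * x)%:R = (r x)%:R :> F by apply/eqP; rewrite natF_eq /r modn_mod.
rewrite E /s ltnNge; case: leqP => /= hr; first by rewrite mul1r.
rewrite natrB; last by rewrite ltnW // ltn_mod prime_gt0.
by rewrite (pchar_Fp_0 pr_p) sub0r expr1 mulN1r opprK.
Qed.

Lemma gauss_perm : perm_eq [seq s x | x <- iota 1 h] (iota 1 h).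
Proof.
have us : uniq [seq s x | x <- iota 1 h].
  rewrite map_inj_in_uniq ?iota_uniq // => i j; rewrite !mem_iota => ip jp sij.
  apply: small_pm; try lia.
  have a0 : (a%:R : F) != 0 by rewrite natF_eq0.
  have Ei := gauss_sign i; have Ej := gauss_sign j; rewrite !natrM in Ei Ej.
  rewrite sij in Ei.
  have : a%:R * i%:R = a%:R * j%:R :> F \/ a%:R * i%:R = a%:R * - j%:R :> F.
    rewrite mulrN Ei Ej; case: (h < r i)%N; case: (h < r j)%N => /=;
      rewrite ?expr0 ?expr1 ?mul1r ?mulN1r ?opprK; by [left | right].
  by case=> /(mulfI a0); [left | right].
have sub : {subset [seq s x | x <- iota 1 h] <= iota 1 h}.
  move=> y /mapP[x]; rewrite !mem_iota => xh ->.
  by have := @gauss_range x; lia.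
apply: uniq_perm => //; first exact: iota_uniq.
by case: (uniq_min_size us sub); rewrite ?size_map ?size_iota.
Qed.

(** Multiplying the congruences a x = ± [s x] over 1 <= x <= h gives a^h h! = ± h!, because [s]
    permutes 1, ..., h. *)
Lemma gauss_lemma : leg p a = (-1) ^+ (\sum_(x <- iota 1 h) (h < r x)%N).
Proof.
apply: signs_inj; rewrite ?leg_signs // ?legE; first by rewrite -signr_odd; case: odd.
rewrite rmorphXn /= rmorphN1.
have nz : \prod_(x <- iota 1 h) (x%:R : F) != 0.
  rewrite prodf_seq_neq0; apply/allP => x; rewrite mem_iota natF_eq0 => xh.
  by apply/negP => /dvdn_leq; have := odd_primeE; lia.
apply: (mulIf nz); transitivity (\prod_(x <- iota 1 h) ((a * x)%:R : F)).
  under [RHS]eq_bigr => x _ do rewrite natrM.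
  by rewrite big_split /= big_const_seq count_predT size_iota -Monoid.iteropE.
under eq_bigr => x _ do rewrite gauss_sign.
rewrite big_split /= -prodrXr; congr (_ * _).
by rewrite -[RHS](perm_big _ gauss_perm) big_map.
Qed.

(** Stated for both parities of [a]: for odd [a] only Eisenstein's sum of floors survives, for a = 2
    only the sum of the x. *)
Lemma gauss_parity :
  odd (\sum_(x <- iota 1 h) (h < r x)%N) =
  odd (\sum_(x <- iota 1 h) (a * x) %/ p) (+) ~~ odd a && odd (\sum_(x <- iota 1 h) x).
Proof.
set mu := (\sum_(x <- _) (h < r x)%N)%N; set fl := (\sum_(x <- _) _ %/ p)%N.
set S := (\sum_(x <- iota 1 h) x)%N.
pose T := (\sum_(x <- iota 1 h) (h < r x) * s x)%N.
(* Sum of a x = p floor(a x / p) + [r x], with [r x] equal to [s x] or p - [s x], and with the [s x]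
   adding up to [S]; the claim is its reduction modulo 2. *)
have : (a * S + 2 * T = p * fl + S + p * mu)%N.
  rewrite /S -[in RHS](perm_big _ gauss_perm) big_map /= !big_distrr /= -!big_split /=.
  apply: eq_bigr => x _; rewrite {1}(divn_eq (a * x) p) -/(r x).
  have : (r x < p)%N by rewrite ltn_mod prime_gt0.
  by rewrite /s ltnNge; case: leqP => /= hr; lia.
move/(congr1 odd); rewrite !oddD !oddM odd_p /=.
rewrite addbF addbb addbF.
by case: (odd a); case: (odd S); case: (odd fl); case: (odd mu).
Qed.

End Gauss.

Lemma leg2 : leg p 2 = (-1) ^+ odd (h * h.+1)./2.
Proof.
have p2 : ~~ (p %| 2)%N.
  by apply/negP => /dvdn_leq; have := odd_primeE; have := half_prime_gt0; lia.
rewrite gauss_lemma // -signr_odd gauss_parity //=.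
(* For x <= h one has 2 x < p, so every floor is 0 and 1 + ... + h remains. *)
rewrite big1_seq ?add0b; last first.
  move=> x; rewrite mem_iota => /andP[_ xh]; apply: divn_small.
  by have := odd_primeE; lia.
congr (_ ^+ (odd _ : nat)); have -> : iota 1 h = index_iota 1 h.+1 by rewrite /index_iota subn1.
have := half_prime_gt0.
elim: h => // k IH _; rewrite big_nat_recr //=.
case: k IH => [|k] IH; first by rewrite big_nil.
rewrite IH //; lia.
Qed.

End OddPrime.

(** The two sums count the lattice points of the box [1, p/2] x [1, q/2] on either side of the line
    p y = q x, which contains none of them. *)
Lemma eisenstein_count (p q : nat) : prime p -> odd p -> prime q -> odd q -> p != q ->
  (\sum_(x <- iota 1 p./2) (q * x) %/ p + \sum_(y <- iota 1 q./2) (p * y) %/ q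
   = p./2 * q./2)%N.
Proof.
move=> pp op pq oq npq.
have fl p' q' : prime p' -> odd p' -> prime q' -> odd q' -> p' != q' ->
  (\sum_(x <- iota 1 p'./2) (q' * x) %/ p' =
   \sum_(x <- iota 1 p'./2) \sum_(y <- iota 1 q'./2) (p' * y < q' * x)%N)%N.
  move=> pp' op' pq' oq' npq'; apply: eq_big_seq => x; rewrite mem_iota => xh.
  set f := (_ %/ _)%N.
  have p0 := prime_gt0 pp'; have pE := odd_primeE op'; have qE := odd_primeE oq'.
  have fE : ((q' * x) %/ p' <= q'./2)%N.
    by rewrite -ltnS ltn_divLR //; nia.
  have cmp y : (0 < y)%N -> (p' * y < q' * x)%N = (y <= f)%N.
    move=> y0; rewrite /f leq_divRL // ltn_neqAle mulnC andb_idl // => _.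
    apply/negP => /eqP E; have : (p' %| q' * x)%N by rewrite -E dvdn_mull.
    rewrite Euclid_dvdM // dvdn_prime2 // (negbTE npq') /=.
    by move/dvdn_leq; lia.
  transitivity (\sum_(y <- iota 1 q'./2) (y <= f)%N)%N; last first.
    by apply: eq_big_seq => y; rewrite mem_iota => yh; rewrite cmp //; lia.
  rewrite -/f in fE; rewrite -(subnKC fE) iotaD big_cat /= [X in (_ + X)%N]big1_seq; last first.
    by move=> y; rewrite mem_iota => /andP[_ yh]; lia.
  rewrite addn0 (eq_big_seq (fun=> 1%N)); first by rewrite sum1_size size_iota.
  by move=> y; rewrite mem_iota => yh; lia.
rewrite (fl p q) // (fl q p) // 1?eq_sym // [X in (_ + X)%N]exchange_big /= -big_split /=.
rewrite (eq_big_seq (fun=> q./2)); first by rewrite big_const_seq count_predT size_iota iter_addn_0 mulnC.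
move=> x; rewrite mem_iota => xh; rewrite -big_split /=.
rewrite (eq_big_seq (fun=> 1%N)); first by rewrite sum1_size size_iota.
move=> y; rewrite mem_iota => yh.
have : (p * y <> q * x)%N.
  move=> E; have : (p %| q * x)%N by rewrite -E dvdn_mulr.
  rewrite Euclid_dvdM // dvdn_prime2 // (negbTE npq) /= => /dvdn_leq.
  by have := odd_primeE op; lia.
by case: ltngtP.
Qed.

Theorem quadratic_reciprocity (p q : nat) :
  prime p -> odd p -> prime q -> odd q -> p != q ->
  leg p q * leg q p = (-1) ^+ (p./2 * q./2).
Proof.
move=> pp op pq oq npq.
have nd p' q' : prime p' -> prime q' -> p' != q' -> ~~ (p' %| q')%N.
  by move=> *; rewrite dvdn_prime2.
rewrite !gauss_lemma ?nd // 1?eq_sym // -(signr_odd _ (\sum_(x <- iota 1 p./2) _)).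
rewrite -(signr_odd _ (\sum_(x <- iota 1 q./2) _)) !gauss_parity ?nd // 1?eq_sym //.
by rewrite oq op /= !addbF !signr_odd -exprD eisenstein_count.
Qed.

End Reciprocity.

(** * Character sums *)

Section Characters.
Local Open Scope ring_scope.

(** A real Dirichlet character, but possibly nonzero at arguments not prime to q, so that a
    character modulo q' is also one modulo every multiple of q'. *)
Definition qchar (q : nat) (f : nat -> int) : Prop :=
  [/\ f 1%N = 1, forall a b : nat, f (a * b)%N = f a * f b,
      forall a, f (a %% q)%N = f a & forall a, f a \in signs].

Lemma signsM (x y : int) : x \in signs -> y \in signs -> x * y \in signs.
Proof. by rewrite !inE => /or3P[]/eqP-> /or3P[]/eqP->. Qed.

Lemma signs_norm (x : int) : x \in signs -> `|x| <= 1.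
Proof. by rewrite !inE => /or3P[]/eqP->. Qed.

Lemma qchar_ext q f g : f =1 g -> qchar q f -> qchar q g.
Proof. by move=> E [f1 fM fq fs]; split=> *; rewrite -!E. Qed.

Lemma qcharM q f g : qchar q f -> qchar q g -> qchar q (fun a => f a * g a).
Proof.
move=> [f1 fM fq fs] [g1 gM gq gs]; split=> [|a b|a|a].
- by rewrite f1 g1.
- by rewrite fM gM; ring.
- by rewrite fq gq.
- exact: signsM.
Qed.

Lemma qchar_principal q : (1 < q)%N -> qchar q (fun a => (coprime a q)%:R).
Proof.
move=> q1; split=> [|a b|a|a]; first by rewrite coprime1n.
- by rewrite coprimeMl; do 2!case: coprime.
- by rewrite coprime_modl.
- by case: coprime.
Qed.

Lemma qchar_dvd q q' f : (q' %| q)%N -> qchar q' f -> qchar q f.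
Proof.
move=> qq [f1 fM fq fs]; split=> // a.
by rewrite -fq modn_dvdm // fq.
Qed.

(** Multiplication by g permutes the residues and changes the sign of the sum. *)
Lemma sum_period_eq0 q f g : (0 < q)%N -> qchar q f -> coprime g q -> f g = -1 ->
  \sum_(0 <= x < q) f x = 0.
Proof.
move=> q0 [f1 fM fq fs] cg fg.
have P : perm_eq [seq ((g * x) %% q)%N | x <- iota 0 q] (iota 0 q).
  have us : uniq [seq ((g * x) %% q)%N | x <- iota 0 q].
    rewrite map_inj_in_uniq ?iota_uniq // => i j; rewrite !mem_iota => iq jq /eqP.
    wlog ij : i j iq jq / (i <= j)%N.
      move=> W E; case: (leqP i j) => ij; first exact: W.
      by apply/esym/W; rewrite 1?eq_sym // ltnW.
    rewrite eq_sym eqn_mod_dvd ?leq_mul2l ?ij ?orbT // -mulnBr Gauss_dvdr 1?coprime_sym //.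
    by have [|k] := posnP (j - i)%N; [lia | move/dvdn_leq; lia].
  have sub : {subset [seq ((g * x) %% q)%N | x <- iota 0 q] <= iota 0 q}.
    by move=> y /mapP[x _ ->]; rewrite mem_iota ltn_mod q0.
  apply: uniq_perm => //; first exact: iota_uniq.
  by case: (uniq_min_size us sub); rewrite ?size_map ?size_iota.
rewrite /index_iota subn0.
have E : \sum_(x <- iota 0 q) f x = - \sum_(x <- iota 0 q) f x.
  rewrite -[LHS](perm_big _ P) big_map /= -sumrN; apply: eq_bigr => x _.
  by rewrite fq fM fg mulN1r.
lia.
Qed.

Lemma norm_sum_le (f : nat -> int) (r : seq nat) (c : int) :
  (forall x, x \in r -> `|f x| <= c) -> `|\sum_(x <- r) f x| <= c * (size r)%:R.
Proof.
elim: r => [|x r IH] H; first by rewrite big_nil normr0 mulr0.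
rewrite big_cons /= mulrSr mulrDr mulr1 addrC.
apply: le_trans (ler_normD _ _) _; apply: lerD.
  by apply: IH => y yr; apply: H; rewrite inE yr orbT.
by apply: H; rewrite mem_head.
Qed.

(** Complete periods cancel, leaving fewer than q terms of absolute value at most 1. *)
Lemma partial_sum_bound q f g y : (0 < q)%N -> qchar q f -> coprime g q -> f g = -1 ->
  `|\sum_(0 <= x < y) f x| <= q%:R.
Proof.
move=> q0 ff cg fg; have s0 := sum_period_eq0 q0 ff cg fg.
case: ff => [f1 fM fq fs].
have step k : \sum_(0 <= x < k * q + y %% q) f x = \sum_(0 <= x < y %% q) f x.
  elim: k => [|k IH]; first by rewrite mul0n add0n.
  rewrite (@big_cat_nat _ _ _ q) //= ?s0 ?add0r; last by rewrite mulSn; lia.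
  rewrite -{1}[q]add0n big_addn -IH mulSn.
  have -> : (q + k * q + y %% q - q = k * q + y %% q)%N by lia.
  by apply: eq_bigr => i _; rewrite -fq modnDr fq.
rewrite (divn_eq y q) step /index_iota subn0.
apply: le_trans (norm_sum_le (c := 1) _) _.
  by move=> x _; apply: signs_norm.
by rewrite mul1r size_iota ler_nat ltnW // ltn_mod.
Qed.

(** * Dirichlet convolution and the hyperbola method *)

Definition bounded_sums (c : int) (f : nat -> int) : Prop :=
  forall y, `|\sum_(1 <= x < y.+1) f x| <= c.

Definition dirichlet_conv (f g : nat -> int) (m : nat) : int :=
  \sum_(d <- divisors m) f d * g (m %/ d)%N.

Lemma sum_multiples (h : nat -> int) (X d : nat) : (0 < d)%N ->
  \sum_(1 <= m < X.+1 | (d %| m)%N) h (m %/ d)%N = \sum_(1 <= e < (X %/ d).+1) h e.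
Proof.
move=> d0; elim: X => [|X IH]; first by rewrite div0n !big_geq.
rewrite big_mkcond big_nat_recr //= -big_mkcond IH divnS //.
by case: (boolP (d %| X.+1)%N) => [|nd]; rewrite ?add0n ?addr0 // add1n [RHS]big_nat_recr.
Qed.

Lemma divisors_filter m : (0 < m)%N ->
  perm_eq (divisors m) [seq d <- index_iota 1 m.+1 | (d %| m)%N].
Proof.
move=> m0; apply: uniq_perm; rewrite ?divisors_uniq ?filter_uniq ?iota_uniq // => d.
rewrite -dvdn_divisors // mem_filter mem_index_iota.
case: (boolP (d %| m)%N) => // dm.
by have := dvdn_leq m0 dm; have := dvdn_gt0 m0 dm; lia.
Qed.

Lemma sum_dconv f g X :
  \sum_(1 <= m < X.+1) dirichlet_conv f g m =
  \sum_(1 <= d < X.+1) \sum_(1 <= e < (X %/ d).+1) f d * g e.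
Proof.
transitivity (\sum_(1 <= m < X.+1) \sum_(1 <= d < X.+1 | (d %| m)%N) f d * g (m %/ d)%N).
  apply: eq_big_nat => m /andP[m0 mX].
  rewrite /dirichlet_conv (perm_big _ (divisors_filter m0)) big_filter /=.
  rewrite [RHS](big_cat_nat _ (n := m.+1)) //=.
  rewrite [X in _ = _ + X]big_nat_cond [X in _ = _ + X]big_pred0 ?addr0 // => d.
  by apply/negP => /andP[/andP[md _] /dvdn_leq]; lia.
rewrite (exchange_big_dep_nat predT) //=; apply: eq_big_nat => d /andP[d0 _].
by rewrite (sum_multiples (fun e => f d * g e)).
Qed.

(** Pairs with d e <= R^2 are split at d = R. Each d <= R leaves a partial sum of [g], at most c;
    the pairs with d > R have e <= R, and each such e leaves a difference of two partial sums of
    [f], at most 2 c. *)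
Lemma hyperbola_bound (f g : nat -> int) (c : int) (R : nat) :
  (forall a, `|f a| <= 1) -> (forall a, `|g a| <= 1) ->
  bounded_sums c f -> bounded_sums c g ->
  `|\sum_(1 <= m < (R * R).+1) dirichlet_conv f g m| <= 3 * c * R%:R.
Proof.
move=> f1 g1 bf bg; rewrite sum_dconv.
have c0 : 0 <= c by apply: le_trans (bf 0%N); apply: normr_ge0.
rewrite (big_cat_nat _ (n := R.+1)) //=; last by nia.
have -> : \sum_(R.+1 <= d < (R * R).+1) \sum_(1 <= e < (R * R %/ d).+1) f d * g e =
          \sum_(1 <= e < R.+1) \sum_(R.+1 <= d < (R * R %/ e).+1) f d * g e.
  transitivity (\sum_(R.+1 <= d < (R * R).+1) \sum_(1 <= e < R.+1 | (d * e <= R * R)%N) f d * g e).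
    apply: eq_big_nat => d /andP[dR _].
    rewrite (big_nat_widen _ _ R.+1).
      by apply: eq_bigl => e; rewrite ltnS leq_divRL 1?mulnC //; lia.
    by rewrite ltnS -ltnS ltn_divLR; nia.
  rewrite (exchange_big_dep_nat predT) //=; apply: eq_big_nat => e /andP[e0 eR].
  rewrite [RHS](big_nat_widen _ _ (R * R).+1); last by rewrite ltnS leq_div.
  by apply: eq_bigl => d; rewrite ltnS leq_divRL.
have -> : 3 * c * R%:R = c * R%:R + 2 * c * R%:R by ring.
have szR : size (index_iota 1 R.+1) = R by rewrite size_iota subn1.
apply: le_trans (ler_normD _ _) _; apply: lerD.
  rewrite -[in leRHS]szR; apply: norm_sum_le => d _.
  rewrite -mulr_sumr normrM -[c]mul1r; apply: ler_pM => //; exact: bg.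
rewrite -[in leRHS]szR; apply: norm_sum_le => e; rewrite mem_index_iota => /andP[e0 eR].
rewrite -mulr_suml normrM -[2 * c]mulr1; apply: ler_pM => //.
have RX : (R <= R * R %/ e)%N by rewrite leq_divRL //; nia.
have := bf (R * R %/ e)%N; rewrite (big_cat_nat _ (n := R.+1)) //=.
have := bf R; set u := \sum_(_ <= _ < R.+1) _; set v := \sum_(_ <= _ < _) _.
by move=> ? ?; lia.
Qed.

(** Lets a twist be absorbed into both factors, so that the hyperbola bound applies to twisted
    sums. *)
Lemma dconv_twist f g phi m : (forall a b, phi (a * b)%N = phi a * phi b) ->
  (0 < m)%N ->
  dirichlet_conv f g m * phi m = dirichlet_conv (fun a => f a * phi a) (fun a => g a * phi a) m.
Proof.
move=> phiM m0; rewrite /dirichlet_conv mulr_suml; apply: eq_big_seq => d.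
by rewrite -dvdn_divisors // => dm; rewrite -{2}(divnK dm) mulnC phiM; ring.
Qed.

End Characters.

(** * Convolutions at prime powers *)

Section PrimePower.
Local Open Scope ring_scope.

Lemma divisors_prime_power q k m : prime q -> (0 < m)%N -> ~~ (q %| m)%N ->
  perm_eq (divisors (q ^ k * m)) [seq (q ^ i * d)%N | i <- index_iota 0 k.+1, d <- divisors m].
Proof.
move=> pq m0 qm; have q0 := prime_gt0 pq.
have qkm0 : (0 < q ^ k * m)%N by rewrite muln_gt0 expn_gt0 q0.
have cop d : (d %| m)%N -> coprime q d.
  by move=> dm; rewrite prime_coprime //; apply: contra qm => /dvdn_trans; apply.
have logE i d : (d %| m)%N -> logn q (q ^ i * d) = i.
  move=> dm; rewrite lognM ?expn_gt0 ?q0 ?(dvdn_gt0 m0 dm) //.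
  by rewrite pfactorK // logn_coprime ?cop // addn0.
apply: uniq_perm; first exact: divisors_uniq.
  apply: allpairs_uniq; rewrite ?iota_uniq ?divisors_uniq //.
  move=> u v Hu Hv; case/allpairsP: Hu => -[i d] [/= _ dm ->].
  case/allpairsP: Hv => -[j e] [/= _ em ->] /= E.
  rewrite -!dvdn_divisors // in dm em.
  have ij : i = j by rewrite -(logE i d dm) E logE.
  move/eqP: E; rewrite ij eqn_pmul2l ?expn_gt0 ?q0 // => /eqP->; by [].
move=> d; rewrite -dvdn_divisors //; apply/idP/allpairsP => [dd|[[i e] /= [ik em ->]]].
  have d0 := dvdn_gt0 qkm0 dd; have [e qe dE] := pfactor_coprime pq d0.
  exists (logn q d, e) => /=; split; last by rewrite mulnC.
    by rewrite mem_index_iota ltnS -(logE k m (dvdnn m)); exact: dvdn_leq_log.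
  rewrite -dvdn_divisors // -(@Gauss_dvdr _ (q ^ k)); last by rewrite coprime_sym coprimeXl.
  by apply: dvdn_trans dd; rewrite {1}dE dvdn_mulr.
rewrite -dvdn_divisors // in em; rewrite mem_index_iota in ik.
by apply: dvdn_mul => //; apply: dvdn_exp2l; lia.
Qed.

Lemma dconv_prime_power (f g : nat -> int) q k m :
  (forall a b, f (a * b)%N = f a * f b) -> (forall a b, g (a * b)%N = g a * g b) ->
  f 1%N = 1 -> g 1%N = 1 -> prime q -> (0 < m)%N -> ~~ (q %| m)%N ->
  dirichlet_conv f g (q ^ k * m) =
  (\sum_(0 <= i < k.+1) f q ^+ i * g q ^+ (k - i)) * dirichlet_conv f g m.
Proof.
move=> fM gM f1 g1 pq m0 qm; have q0 := prime_gt0 pq.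
have fX i : f (q ^ i)%N = f q ^+ i by elim: i => // i IH; rewrite expnS fM IH exprS.
have gX i : g (q ^ i)%N = g q ^+ i by elim: i => // i IH; rewrite expnS gM IH exprS.
rewrite /dirichlet_conv (perm_big _ (divisors_prime_power k pq m0 qm)) big_allpairs_dep /=.
rewrite mulr_suml; apply: eq_big_seq => i; rewrite mem_index_iota => ik.
rewrite mulr_sumr; apply: eq_big_seq => d; rewrite -dvdn_divisors // => dm.
have -> : (q ^ k * m %/ (q ^ i * d) = q ^ (k - i) * (m %/ d))%N.
  have -> : (q ^ k = q ^ (k - i) * q ^ i)%N by rewrite -expnD subnK //; lia.
  rewrite [(_ * q ^ i)%N]mulnC -mulnA divnMl ?expn_gt0 ?q0 //.
  by rewrite muln_divA.
by rewrite fM gM fX gX; ring.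
Qed.

End PrimePower.

(** * Existence of an integer with prescribed character values *)

Section Existence.
Local Open Scope ring_scope.

Variables (Q : nat) (chi : nat -> int).
Hypothesis Q1 : (1 < Q)%N.
Hypothesis chi_char : qchar Q chi.
Hypothesis chi_eq0 : forall a, (chi a == 0) = ~~ coprime a Q.

Let alpha (a : nat) : int := (coprime a Q)%:R.
Let A := dirichlet_conv alpha chi.

(** The support of [A]: inert primes occur to an even power, and primes dividing Q do not occur. *)
Definition split_by (m : nat) : Prop := forall q, prime q -> (q %| m)%N ->
  chi q != 0 /\ (chi q = -1 -> ~~ odd (logn q m)).

(** For q prime to Q the factor is k + 1 or the indicator of even k, according to the sign [chi q].
    For q dividing Q both characters vanish at q, and only k = 0 gives a nonzero value, by 0^0 =
    1. *)
Lemma euler_factor q k : prime q -> let E := \sum_(0 <= i < k.+1) alpha q ^+ i * chi q ^+ (k - i) in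
  0 <= E /\ (E != 0 <-> k = 0%N \/ chi q != 0 /\ (chi q = -1 -> ~~ odd k)).
Proof.
move=> pq /=; case: chi_char => [_ _ _ /(_ q)]; rewrite !inE.
have := chi_eq0 q; rewrite /alpha; case: (boolP (chi q == 0)) => [/eqP c0|c0].
  move=> /esym/negbTE -> _; rewrite c0.
  case: k => [|k]; first by rewrite big_nat1 !expr0 mulr1; split => //; split => // _; left.
  rewrite big1_seq; first by split => //; split=> [/eqP|[|[]]].
  move=> i; rewrite mem_index_iota => ik; rewrite !expr0n.
  by case: i ik => [|i] ik /=; rewrite ?mul0r // subn0 mulr0.
move=> /esym/negbFE -> /=.
have -> : \sum_(0 <= i < k.+1) 1%:R ^+ i * chi q ^+ (k - i) = \sum_(0 <= i < k.+1) chi q ^+ i.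
  rewrite big_nat_rev /=; apply: eq_big_nat => i ik.
  by rewrite expr1n mul1r; congr (_ ^+ _); lia.
case/orP => /eqP cE; rewrite cE.
  have -> : \sum_(0 <= i < k.+1) (1 : int) ^+ i = k.+1%:R.
    rewrite (eq_bigr (fun=> 1)) => [|i _]; last exact: expr1n.
    by rewrite big_const_nat subn0 iter_addr_0.
  have kn0 : (k.+1%:R : int) != 0 by rewrite pnatr_eq0.
  by split => //; split => // _; right; split.
have -> : \sum_(0 <= i < k.+1) (-1 : int) ^+ i = (~~ odd k)%:R.
  elim: k => [|k IH]; first by rewrite big_nat1.
  by rewrite big_nat_recr //= IH -signr_odd /=; case: (odd k).
case: (boolP (odd k)) => ok; split => //=; split => //.
- by case=> [k0|[_ /(_ erefl)]] //; rewrite k0 in ok.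
- by move=> _; right; split.
Qed.

Lemma dconv_split m : (0 < m)%N -> 0 <= A m /\ (A m != 0 <-> split_by m).
Proof.
case: (qchar_principal Q1) => [a1 aM _ _]; case: chi_char => [c1 cM _ _].
elim/ltn_ind: m => m IH m0; have [m1|m_neq1] := eqVneq m 1%N.
  rewrite m1 /A /dirichlet_conv; have -> : divisors 1 = [:: 1%N] by [].
  rewrite big_seq1 divnn /alpha c1 a1; split=> //; split=> // _ q pq.
  by rewrite dvdn1 => /eqP q1; rewrite q1 in pq.
have m_gt1 : (1 < m)%N by rewrite ltn_neqAle eq_sym m_neq1.
set q := pdiv m; have pq : prime q := pdiv_prime m_gt1.
have [m' qm' mE] := pfactor_coprime pq m0; set k := logn q m in mE.
have k0 : (0 < k)%N by rewrite /k logn_gt0 mem_primes pq m0 pdiv_dvd.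
have m'0 : (0 < m')%N by move: m0; rewrite mE muln_gt0 => /andP[].
have m'm : (m' < m)%N.
  rewrite mE -[X in (X < _)%N]muln1 ltn_pmul2l // -(expn0 q) ltn_exp2l //.
  exact: prime_gt1.
have nqm' : ~~ (q %| m')%N by rewrite -prime_coprime.
have [A0 AE] := IH _ m'm m'0; have [E0 EE] := euler_factor k pq.
have AmE : A m = (\sum_(0 <= i < k.+1) alpha q ^+ i * chi q ^+ (k - i)) * A m'.
  by rewrite {1}mE mulnC; apply: dconv_prime_power.
have logr r : prime r -> r != q -> logn r m = logn r m'.
  move=> pr rq; have qk0 : (0 < q ^ k)%N by rewrite expn_gt0 prime_gt0.
  rewrite {1}mE lognM // lognX (logn_prime _ pq).
  by rewrite (negbTE rq) muln0 addn0.
have dvdr r : prime r -> r != q -> (r %| m)%N = (r %| m')%N.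
  move=> pr rq; rewrite mE Euclid_dvdM // Euclid_dvdX // (dvdn_prime2 pr pq).
  by rewrite (negbTE rq) andFb orbF.
rewrite AmE; split; first exact: mulr_ge0.
rewrite mulf_eq0 negb_or; split.
  move/andP => [/EE En0 /AE sm'] r pr; have [->|rq] := eqVneq r q.
    by move=> _; case: En0 => [k0'|//]; rewrite k0' in k0.
  by rewrite dvdr // logr // => /(sm' _ pr).
move=> sm; apply/andP; split.
  by apply/EE; right; apply: (sm q pq); apply: pdiv_dvd.
apply/AE => r pr rm'.
have rq : r != q by apply: contraNneq nqm' => <-.
by rewrite -logr //; apply: sm => //; rewrite dvdr.
Qed.

Variables (psi : nat -> nat -> int) (eps : nat -> int) (l : seq nat).
Hypothesis l_uniq : uniq l.
Hypothesis psi_char : forall p, p \in l -> qchar Q (psi p).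
Hypothesis psi_neq0 : forall p a, p \in l -> coprime a Q -> psi p a != 0.
Hypothesis eps_pm1 : forall p, p \in l -> eps p = 1 \/ eps p = -1.
Hypothesis psi_independent : forall p, p \in l -> exists g, [/\ coprime g Q, psi p g = -1 &
  forall p', p' \in l -> p' != p -> psi p' g = 1].
Hypothesis chi_independent : exists g, [/\ coprime g Q, chi g = -1 &
  forall p, p \in l -> psi p g = 1].

(** Detects the prescribed signs: at m prime to Q, for t contained in [l], it is 2^(size t) if
    [psi p m = eps p] for all p in t, and 0 otherwise. *)
Let W (t : seq nat) (m : nat) : int := \prod_(p <- t) (1 + eps p * psi p m).
Let phi (t : seq nat) (m : nat) : int := \prod_(p <- t) psi p m.

Lemma qchar_mul_phi f t : {subset t <= l} -> qchar Q f -> qchar Q (fun a => f a * phi t a).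
Proof.
move=> + ff; elim: t => [|p t IH] sub.
  by apply: qchar_ext ff => a; rewrite /phi big_nil mulr1.
have sp : p \in l by apply: sub; rewrite mem_head.
have st : {subset t <= l} by move=> x xt; apply: sub; rewrite inE xt orbT.
apply: qchar_ext (qcharM (IH st) (psi_char sp)) => a.
by rewrite /phi big_cons mulrCA mulrC.
Qed.

Lemma bounded_char_sums f g : qchar Q f -> f 0%N = 0 -> coprime g Q -> f g = -1 ->
  bounded_sums Q%:R f.
Proof.
move=> ff f0 cg fg y.
have := partial_sum_bound y.+1 (ltnW Q1) ff cg fg.
by rewrite big_ltn // f0 add0r.
Qed.

Lemma phiM t a b : {subset t <= l} -> phi t (a * b)%N = phi t a * phi t b.
Proof.
move=> sub; rewrite /phi -big_split /=; apply: eq_big_seq => p /sub pl.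
by case: (psi_char pl) => _ ->.
Qed.

(** Expanding [W l'] gives 2^(size l') sums, each twisted by a nonempty product of the [psi p]. Such
    a twist makes both [alpha] and [chi] nontrivial, so the hyperbola method bounds each sum by 3 Q
    R. *)
Lemma twisted_sum_bound t l' R : (0 < size t)%N -> uniq (t ++ l') -> {subset t ++ l' <= l} ->
  `|\sum_(1 <= m < (R * R).+1) A m * phi t m * W l' m| <= (2 ^ size l' * 3 * Q * R)%:R.
Proof.
elim: l' t => [|p l' IH] t t0 ut st; last first.
  have -> : \sum_(1 <= m < (R * R).+1) A m * phi t m * W (p :: l') m =
    \sum_(1 <= m < (R * R).+1) A m * phi t m * W l' m +
    eps p * \sum_(1 <= m < (R * R).+1) A m * phi (p :: t) m * W l' m.
    rewrite mulr_sumr -big_split /=; apply: eq_bigr => m _.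
    by rewrite /W /phi !big_cons; ring.
  have P : perm_eq (t ++ p :: l') ((p :: t) ++ l') by rewrite -cat_rcons perm_cat2r perm_rcons.
  have pl : p \in l by apply: st; rewrite mem_cat mem_head orbT.
  have B1 := IH t t0 _ _; have B2 := IH (p :: t) isT _ _.
  apply: le_trans (ler_normD _ _) _.
  have -> : (2 ^ size (p :: l') * 3 * Q * R)%:R =
            (2 ^ size l' * 3 * Q * R)%:R + (2 ^ size l' * 3 * Q * R)%:R :> int.
    by rewrite -natrD /= expnS; congr (_%:R); lia.
  apply: lerD.
    apply: B1.
      by move: ut; rewrite !cat_uniq /= negb_or => /and3P[-> /andP[_ ->] /andP[_ ->]].
    by move=> x; rewrite mem_cat => /orP[] xt; apply: st; rewrite mem_cat ?inE xt ?orbT.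
  rewrite normrM; have -> : `|eps p| = 1 by case: (eps_pm1 pl) => ->; rewrite ?normrN normr1.
  rewrite mul1r; apply: B2; first by rewrite -(perm_uniq P).
  by move=> x; rewrite -(perm_mem P) => /st.
rewrite cats0 in ut st.
have -> : \sum_(1 <= m < (R * R).+1) A m * phi t m * W [::] m =
   \sum_(1 <= m < (R * R).+1) dirichlet_conv (fun a => alpha a * phi t a) (fun a => chi a * phi t a) m.
  apply: eq_big_nat => m /andP[m0 _].
  by rewrite /W big_nil mulr1 /A dconv_twist // => a b; apply: phiM.
have fc := qchar_mul_phi st (qchar_principal Q1); have gc := qchar_mul_phi st chi_char.
case: (t) t0 ut st fc gc => [//|p t' _ ut st fc gc].
(* [g] witnesses that the twist of [alpha] is nontrivial, and [g'] does so for the twist of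
   [chi]. *)
have pl : p \in l by apply: st; rewrite mem_head.
have [g [cg pg og]] := psi_independent pl; have [g' [cg' chg og']] := chi_independent.
have phig : phi (p :: t') g = -1.
  rewrite /phi big_cons pg big1_seq ?mulr1 // => p' /andP[_ pt]; apply: og.
    by apply: st; rewrite inE pt orbT.
  by apply: contraTneq ut => <-; rewrite /= pt.
have phig' : phi (p :: t') g' = 1 by rewrite /phi big1_seq // => p' /andP[_ /st/og'].
have c0 : coprime 0 Q = false by rewrite /coprime gcd0n; apply/negbTE; lia.
have chi0 : chi 0%N = 0 by apply/eqP; rewrite chi_eq0 c0.
have -> : (2 ^ size (Nil nat) * 3 * Q * R)%:R = 3 * Q%:R * R%:R :> int.
  by rewrite expn0 mul1n !natrM.
apply: hyperbola_bound.
- by move=> a; case: fc => _ _ _ fs; apply: signs_norm (fs a).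
- by move=> a; case: gc => _ _ _ gs; apply: signs_norm (gs a).
- apply: (bounded_char_sums (g := g)) => //; first by rewrite /alpha c0 mul0r.
  by rewrite /alpha cg phig mul1r.
- apply: (bounded_char_sums (g := g')) => //; first by rewrite chi0 mul0r.
  by rewrite chg phig' mulr1.
Qed.

(** The empty product in the expansion of [W l'] gives the main term; every factor peeled off adds
    one twisted sum, which at most doubles the allowed error. *)
Lemma weighted_sum_lower_bound l' R : uniq l' -> {subset l' <= l} ->
  \sum_(1 <= m < (R * R).+1) A m - (2 ^ size l' * 3 * Q * R)%:R <=
  \sum_(1 <= m < (R * R).+1) A m * W l' m.
Proof.
elim: l' => [|p l' IH] /= ul sl.
  rewrite /W; under [leRHS]eq_bigr do rewrite big_nil mulr1.
  by rewrite gerDl oppr_le0.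
case/andP: ul => pl' ul'.
have pl : p \in l by apply: sl; rewrite mem_head.
have sl' : {subset l' <= l} by move=> x xt; apply: sl; rewrite inE xt orbT.
have -> : \sum_(1 <= m < (R * R).+1) A m * W (p :: l') m =
    \sum_(1 <= m < (R * R).+1) A m * W l' m +
    eps p * \sum_(1 <= m < (R * R).+1) A m * phi [:: p] m * W l' m.
  rewrite mulr_sumr -big_split /=; apply: eq_bigr => m _.
  by rewrite /W /phi !big_cons big_nil; ring.
have B := @twisted_sum_bound [:: p] l' R isT _ _.
have {}B : `|\sum_(1 <= m < (R * R).+1) A m * phi [:: p] m * W l' m|
   <= (2 ^ size l' * 3 * Q * R)%:R by apply: B; rewrite //= pl'.
have := IH ul' sl'; rewrite expnS.
have -> : (2 * 2 ^ size l' * 3 * Q * R)%:R =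
  (2 ^ size l' * 3 * Q * R)%:R + (2 ^ size l' * 3 * Q * R)%:R :> int.
  by rewrite -natrD; congr (_%:R); lia.
move: B; set u := \sum_(_ <= _ < _) _; set c := (_)%:R; set v := \sum_(_ <= _ < _) _.
set w := \sum_(_ <= _ < _) _.
by case: (eps_pm1 pl) => ->; lia.
Qed.

Theorem exists_split_with_signs :
  (forall C : nat, exists R : nat, (C * R)%:R < \sum_(1 <= m < (R * R).+1) A m) ->
  exists m, [/\ (0 < m)%N, split_by m & forall p, p \in l -> psi p m = eps p].
Proof.
move=> /(_ (2 ^ size l * 3 * Q)%N) [R big].
have /eqP : \sum_(1 <= m < (R * R).+1) A m * W l m != 0.
  have := weighted_sum_lower_bound R l_uniq (fun x => id).
  move: big; set c := (_ * R)%:R; set u := \sum_(_ <= _ < _) _.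
  set v := \sum_(_ <= _ < _) _; lia.
have [/hasP[m]|/hasPn none] := boolP (has (fun m => A m * W l m != 0) (index_iota 1 (R * R).+1)).
  rewrite mem_index_iota mulf_eq0 negb_or => /andP[m0 _] /andP[/(dconv_split m0).2 sm].
  rewrite prodf_seq_neq0 => /allP Wm _.
  exists m; split=> // p pl; have /= := Wm p pl.
  have cm : coprime m Q.
    rewrite coprime_has_primes //; last exact: ltnW.
    apply/hasPn => q; rewrite !mem_primes => /and3P[pq Q0 qQ].
    apply/negP => /and3P[_ _ qm]; have [+ _] := sm q pq qm.
    rewrite chi_eq0 negbK prime_coprime // qQ; by [].
  case: (psi_char pl) => _ _ _ /(_ m); rewrite !inE (negbTE (psi_neq0 pl cm)) /=.
  by case: (eps_pm1 pl) => -> /orP[]/eqP->.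
by rewrite big1_seq // => m /andP[_ /none /negPn /eqP].
Qed.

End Existence.

(** * The genus characters *)

Section OddCharacters.
Local Open Scope ring_scope.

(* [k4 d] and [k8 d] are the symbols (-1/d) and (2/d), and 0 for even [d]. *)
Definition k4 (d : nat) : int := nth 0 [:: 0; 1; 0; -1; 0; 1; 0; -1] (d %% 8).
Definition k8 (d : nat) : int := nth 0 [:: 0; 1; 0; -1; 0; -1; 0; 1] (d %% 8).

Lemma nth8_char (s : seq int) :
  all (fun a => all (fun b => nth 0 s ((a * b) %% 8)%N == nth 0 s a * nth 0 s b) (iota 0 8))
    (iota 0 8) ->
  nth 0 s 1 = 1 -> all [in signs] s -> qchar 8 (fun d => nth 0 s (d %% 8)%N).
Proof.
move=> mult s1 ss; split=> [//|a b|a|a]; last 1 first.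
- by have /all_nthP := ss; have [?|?] := ltnP (a %% 8)%N (size s); [apply | rewrite nth_default].
- have m8 c : (c %% 8)%N \in iota 0 8 by rewrite mem_iota ltn_mod.
  by have /allP/(_ _ (m8 a))/allP/(_ _ (m8 b))/eqP <- := mult; rewrite modnMm.
- by rewrite modn_mod.
Qed.

Lemma k4_char : qchar 8 k4. Proof. exact: nth8_char. Qed.
Lemma k8_char : qchar 8 k8. Proof. exact: nth8_char. Qed.

Lemma k4_odd d : odd d -> k4 d = (-1) ^+ d./2.
Proof.
move=> od; rewrite -signr_odd /k4; have : (d %% 8 < 8)%N by rewrite ltn_mod.
have dE := divn_eq d 8; move: dE; move: (d %% 8)%N (d %/ 8)%N => r c dE r8.
have -> : odd d./2 = odd r./2 by lia.
have {}od : odd r by lia.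
by move: r r8 od {dE}; do 8?[case=> //].
Qed.

Lemma k8_odd d : odd d -> k8 d = (-1) ^+ odd (d./2 * d./2.+1)./2.
Proof.
move=> od; rewrite /k8; have : (d %% 8 < 8)%N by rewrite ltn_mod.
have dE := divn_eq d 8; move: dE; move: (d %% 8)%N (d %/ 8)%N => r c dE r8.
have dh : d./2 = (4 * c + r./2)%N by lia.
have -> : odd (d./2 * d./2.+1)./2 = odd (r./2 * r./2.+1)./2.
  have E : (d./2 * d./2.+1 = r./2 * r./2.+1 + (8 * (c * c) + 4 * (c * r./2) + 2 * c).*2)%N.
    by rewrite dh; nia.
  by rewrite E halfD odd_double doubleK andbF add0n oddD; lia.
have {}od : odd r by lia.
by move: r r8 od {dE dh}; do 8?[case=> //].
Qed.

Lemma leg_char p : prime p -> odd p -> qchar p (leg p).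
Proof.
move=> pp op; split; first exact: leg1.
- exact: legM.
- by move=> a; apply: leg_mod => //; rewrite modn_mod.
- exact: leg_signs.
Qed.

Lemma leg_prod p t : prime p -> odd p ->
  leg p (\prod_(q <- t) q)%N = \prod_(q <- t) leg p q.
Proof.
move=> pp op; elim: t => [|q t IH]; first by rewrite !big_nil leg1.
by rewrite !big_cons legM // IH.
Qed.

Lemma leg_sq p a : prime p -> odd p -> ~~ (p %| a)%N -> leg p a * leg p a = 1.
Proof. by move=> pp op pa; case: (leg_pm1 pp pa) => ->. Qed.

(** As [leg] takes natural numbers, [p.-1] plays the role of -1 modulo p, here and below. *)
Lemma leg_opp_sqr p a : prime p -> odd p -> leg p (a * p.-1) = 1 ->
  exists x, (p %| x * x + a)%N.
Proof.
move=> pp op /(leg1_sqr pp op)[x xE]; exists x.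
rewrite /dvdn -modnDml xE modnDml -mulnSr prednK ?prime_gt0 //.
by rewrite modnMl.
Qed.

(** Descent: if q divides x^2 + n y^2 while -n is a nonresidue, then q divides y, since otherwise -n
    would be the square of x/y; hence q divides x too, and q^2 can be removed. *)
Lemma logn_norm_even n q x y : prime q -> odd q -> leg q (n * q.-1) = -1 ->
  (0 < x * x + n * (y * y))%N -> ~~ odd (logn q (x * x + n * (y * y))).
Proof.
move=> pq oq lq; move mE : (x * x + n * (y * y))%N => m.
elim/ltn_ind: m x y mE => m IH x y mE m0.
have [qm|qm] := boolP (q %| m)%N; last by rewrite logn_coprime // prime_coprime.
have q1 := prime_gt1 pq.
have qy : (q %| y)%N.
  apply/negPn/negP => qy.
  have : (x * x = n * q.-1 * (y * y) %[mod q])%N.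
    apply/eqP; rewrite -(eqn_modDr (n * (y * y))) mE.
    have -> : (n * q.-1 * (y * y) + n * (y * y) = n * (y * y) * q)%N.
      by rewrite -[q in RHS](prednK (ltnW q1)) mulnS; lia.
    by rewrite modnMl; apply/eqP/eqP.
  move/leg_mod => /(_ pq); rewrite (legM pq oq x) (legM pq oq (n * q.-1)%N) (legM pq oq y) lq.
  rewrite (leg_sq pq oq qy) mulr1 => E.
  by have := sqr_ge0 (leg q x); rewrite expr2 E.
have qx : (q %| x)%N.
  have : (q %| x * x)%N.
    by rewrite -(dvdn_addl _ (dvdn_mull n (dvdn_mulr y qy))) mE.
  by rewrite Euclid_dvdM // orbb.
case/dvdnP: qx mE => x' ->; case/dvdnP: qy => y' -> mE.
have m'E : (m = q ^ 2 * (x' * x' + n * (y' * y')))%N by rewrite -mE; ring.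
have m'0 : (0 < x' * x' + n * (y' * y'))%N by move: m0; rewrite m'E muln_gt0 => /andP[].
rewrite m'E lognM ?expn_gt0 ?(ltnW q1) // pfactorK // oddD /=.
apply: IH => //; rewrite m'E -[X in (X < _)%N]mul1n ltn_pmul2r //.
by rewrite -(exp1n 2) ltn_exp2r.
Qed.

End OddCharacters.

(** * Squarefree parts and square roots modulo products of primes *)

Section Squarefree.
Local Open Scope nat_scope.

Lemma prime_dvd_prod q t : prime q -> all prime t -> (q %| \prod_(p <- t) p) = (q \in t).
Proof.
move=> pq; elim: t => [|p t IH] /=; first by rewrite big_nil dvdn1; case: q pq => [|[]].
by case/andP => pp pt; rewrite big_cons Euclid_dvdM // IH // dvdn_prime2.
Qed.

Lemma coprime_prod_primes a t : all prime t ->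
  coprime a (\prod_(p <- t) p) = all (fun p => ~~ (p %| a)) t.
Proof.
elim: t => [|p t IH] /=; first by rewrite big_nil coprimen1.
by case/andP => pp pt; rewrite big_cons coprimeMr IH // coprime_sym prime_coprime.
Qed.

Lemma squarefree_decomposition m : 0 < m ->
  exists t s, [/\ uniq t, all prime t & m = \prod_(p <- t) p * (s * s)].
Proof.
elim/ltn_ind: m => m IH m0; have [->|m1] := eqVneq m 1.
  by exists [::], 1; rewrite big_nil.
have mgt1 : 1 < m by rewrite ltn_neqAle eq_sym m1.
set q := pdiv m; have pq : prime q := pdiv_prime mgt1.
have /dvdnP[m' mE] : q %| m := pdiv_dvd m.
have m'0 : 0 < m' by case: m' mE m0 => // ->.
have [|t [s [ut pt m'E]]] := IH m' _ m'0.
  by rewrite mE -[X in X < _]muln1 ltn_pmul2l // prime_gt1.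
have [qt|qt] := boolP (q \in t); last first.
  by exists (q :: t), s; rewrite /= qt ut pq pt big_cons mE m'E; split=> //; ring.
exists (rem q t), (q * s); split; first exact: rem_uniq.
  by apply/allP => x /mem_rem /(allP pt).
by rewrite mE m'E (perm_big _ (perm_to_rem qt)) big_cons /=; ring.
Qed.

Lemma logn_squarefree_mul q t s : prime q -> uniq t -> all prime t -> q \in t -> 0 < s ->
  odd (logn q (\prod_(p <- t) p * (s * s))).
Proof.
move=> pq ut pt qt s0; rewrite (perm_big _ (perm_to_rem qt)) big_cons /=.
have pr : all prime (rem q t) by apply/allP => x /mem_rem /(allP pt).
have r0 : 0 < \prod_(p <- rem q t) p.
  by rewrite big_seq; apply: prodn_cond_gt0 => p /(allP pr) /prime_gt0.
have qr : coprime q (\prod_(p <- rem q t) p).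
  by rewrite prime_coprime // prime_dvd_prod // mem_rem_uniq // inE eqxx.
rewrite !lognM ?muln_gt0 ?s0 ?r0 ?prime_gt0 // logn_prime // eqxx logn_coprime //.
by rewrite addn0 oddD addnn odd_double.
Qed.

Lemma crt_sqr t c : uniq t -> all prime t ->
  (forall q, q \in t -> exists x, q %| x * x + c) ->
  exists x, \prod_(q <- t) q %| x * x + c.
Proof.
elim: t => [|q t IH] /=; first by exists 0; rewrite big_nil dvd1n.
case/andP => qt ut /andP[pq pt] H.
have [|x xE] := IH ut pt; first by move=> p ptt; apply: H; rewrite inE ptt orbT.
have [y yE] := H q (mem_head _ _).
have cop : coprime q (\prod_(p <- t) p) by rewrite prime_coprime // prime_dvd_prod.
exists (chinese q (\prod_(p <- t) p) y x); set z := chinese _ _ _ _.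
have zq : z = y %[mod q] by apply: chinese_modl.
have zt : z = x %[mod \prod_(p <- t) p] by apply: chinese_modr.
rewrite big_cons Gauss_dvd // /dvdn -!(modnDml (z * z)).
rewrite -(modnMm z z q) zq modnMm -(modnMm z z (\prod_(p <- t) p)) zt modnMm.
by rewrite !modnDml; apply/andP.
Qed.

End Squarefree.

(** * Many values of the norm form *)

Section NormFamily.
Local Open Scope nat_scope.

(* Values of x^2 + n y^2 with x = 1 mod 2n and y even, hence prime to 2n. *)
Definition norm_family n i j := (2 * n * i + 1) * (2 * n * i + 1) + n * (2 * j * (2 * j)).

(** From i = Y^2 on, raising i by one increases the first square by more than the term 4 n j^2 with
    j < Y can amount to; so different i give different values. *)
Lemma norm_family_lt n Y i1 i2 j1 j2 : 0 < n -> Y * Y <= i1 -> i1 < i2 -> j1 < Y ->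
  norm_family n i1 j1 < norm_family n i2 j2.
Proof.
move=> n0 Ii lti ltj; rewrite /norm_family.
have h1 : n * (j1 * j1) <= n * i1.
  by rewrite leq_mul2l (leq_trans _ Ii) ?orbT // leq_mul // ltnW.
have h3 : n * i1 + n <= n * i2 by rewrite -mulnSr leq_mul2l lti orbT.
have h5 : n * i1 <= n * i1 * (n * 1) by rewrite muln1; apply: leq_pmulr.
have h4 : (2 * (n * i1 + n) + 1) * (2 * (n * i1 + n) + 1) <=
    (2 * (n * i2) + 1) * (2 * (n * i2) + 1) by apply: leq_mul; lia.
have -> : 2 * n * i1 = 2 * (n * i1) by rewrite mulnA.
have -> : 2 * n * i2 = 2 * (n * i2) by rewrite mulnA.
move: (n * i1) (n * i2) h1 h3 h4 h5 => u v; lia.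
Qed.

Lemma norm_family_le n i j I K Y : i <= I + K -> j <= Y ->
  norm_family n i j <= (2 * n * (I + K) + 1 + 2 * n * Y) * (2 * n * (I + K) + 1 + 2 * n * Y).
Proof.
move=> iK jY; rewrite /norm_family.
have h1 : 2 * n * i <= 2 * n * (I + K) by rewrite leq_mul2l iK orbT.
have h2 : 2 * n * j <= 2 * n * Y by rewrite leq_mul2l jY orbT.
apply: leq_trans (leq_mul (leq_add (leq_add h1 (leqnn 1)) h2) (leq_add (leq_add h1 (leqnn 1)) h2)).
have : n * (j * j) <= n * (j * j) * (n * 1).
  by rewrite muln1; case: (posnP n) => [->//|n0]; apply: leq_pmulr.
lia.
Qed.

(** With R the root of the bound in [norm_family_le], C R = 2 n C K + C (2 n I + 1 + 2 n Y), while K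
    Y = 2 n C K + K: [Y] is chosen to match the slope and [K] to exceed the constant. *)
Lemma norm_family_count n C : let Y := 2 * n * C + 1 in let I := Y * Y in
  let K := C * (2 * n * I + 1 + 2 * n * Y) + 1 in
  C * (2 * n * (I + K) + 1 + 2 * n * Y) < K * Y.
Proof. by move=> /=; lia. Qed.

End NormFamily.

(** * The characters attached to a squarefree n *)

Section GenusCharacters.
Local Open Scope ring_scope.

Variables (b : bool) (l : seq nat).
Hypotheses (l_uniq : uniq l) (l_odd : all (fun p => prime p && odd p) l).
Let N := (\prod_(p <- l) p)%N.
(** The squarefree number to be represented: [l] lists its odd primes and [b] tells whether it is
    even. *)
Let n := ((if b then 2 else 1) * N)%N.
Hypothesis n_mod4 : ~~ b -> (N %% 4 = 1)%N.

(* The 2-adic part of the symbol (-n/d) once (N/d) has been turned into (d/N); [k4 N] is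
   the sign coming from reciprocity. *)
Definition kappa (d : nat) : int :=
  if b then (if k4 N == 1 then k4 d * k8 d else k8 d) else k4 d.

(** A product of characters in d, so that multiplicativity and the period 8 N are immediate; its
    equality with the symbol (-n/q) at primes is the content of [chi_reciprocity]. *)
Definition chi (d : nat) : int := kappa d * \prod_(p <- l) leg p d.

Let Q := (8 * N)%N.

Let l_pr p : p \in l -> prime p. Proof. by move/(allP l_odd)/andP => []. Qed.
Let l_od p : p \in l -> odd p. Proof. by move/(allP l_odd)/andP => []. Qed.
Let l_prime : all prime l. Proof. by apply/allP => p /l_pr. Qed.

Let N_gt0 : (0 < N)%N.
Proof. by rewrite /N big_seq; apply: prodn_cond_gt0 => p /l_pr /prime_gt0. Qed.

Let N_odd : odd N.
Proof.
rewrite /N; elim: (l) l_odd => [|p t IH] /=; first by rewrite big_nil.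
by case/andP => /andP[_ op] pt; rewrite big_cons oddM op IH.
Qed.

Let Q_gt1 : (1 < Q)%N. Proof. by rewrite /Q; lia. Qed.

Let coprime8 a : coprime a 8 = odd a.
Proof. by rewrite -[8%N]/(2 ^ 3)%N coprime_pexpr // coprimen2. Qed.

Lemma kappa_char : qchar 8 kappa.
Proof.
have k48 := qcharM k4_char k8_char; have [k4c k8c] := (k4_char, k8_char).
have [E|E] := eqVneq b true; rewrite /qchar /kappa ?E //; last first.
  by case: b E.
by case: ifP.
Qed.

Lemma kappa_eq0 d : (kappa d == 0) = ~~ odd d.
Proof.
have : (d %% 8 < 8)%N by rewrite ltn_mod.
rewrite -(odd_mod d (erefl : odd 8 = false)) /kappa /k4 /k8; move: (d %% 8)%N => r r8.
case: b; last by move: r r8; do 8?[case=> //].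
by case: (_ == 1); move: r r8; do 8?[case=> //].
Qed.

Lemma kappa_nontrivial : exists2 g, odd g & kappa g = -1.
Proof.
rewrite /kappa; case: b; last by exists 3.
by case: (k4 N == 1); [exists 5 | exists 3].
Qed.

Lemma leg_charQ p : p \in l -> qchar Q (leg p).
Proof.
move=> pl; apply: qchar_dvd (leg_char (l_pr pl) (l_od pl)).
by apply: dvdn_mull; rewrite prime_dvd_prod ?l_pr.
Qed.

Lemma qchar_prod_leg f t : {subset t <= l} -> qchar Q f ->
  qchar Q (fun d => f d * \prod_(p <- t) leg p d).
Proof. exact: (qchar_mul_phi leg_charQ). Qed.

Lemma chi_char : qchar Q chi.
Proof.
apply: qchar_prod_leg => //; apply: qchar_dvd kappa_char; exact: dvdn_mulr.
Qed.

Lemma coprimeQ a : coprime a Q = odd a && all (fun p => ~~ (p %| a)%N) l.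
Proof. by rewrite /Q coprimeMr coprime8 coprime_prod_primes. Qed.

Lemma chi_eq0 a : (chi a == 0) = ~~ coprime a Q.
Proof.
rewrite /chi mulf_eq0 kappa_eq0 coprimeQ negb_and; congr (_ || _).
elim: (l) l_odd => [|p t IH] /=; first by rewrite big_nil oner_eq0.
case/andP => /andP[pp op] pt; rewrite big_cons mulf_eq0 IH // negb_and leg_eq0 //.
by rewrite negbK.
Qed.

Lemma chi_reciprocity q : prime q -> odd q -> q \notin l -> chi q = leg q (n * q.-1).
Proof.
move=> pq oq ql.
have nl p : p \in l -> p != q by move=> pl; apply: contraNneq ql => <-.
rewrite legM // leg_opp // -k4_odd // /n legM // leg_prod //.
(* Every (p/q) is flipped to (q/p); the reciprocity signs collect into a power of [k4 N]. *)
have rec : \prod_(p <- l) leg q p = \prod_(p <- l) leg p q * (k4 N) ^+ q./2.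
  have -> : k4 N = \prod_(p <- l) k4 p.
    rewrite /N; elim: (l) => [|p t IH]; first by rewrite !big_nil.
    by case: k4_char => _ kM _ _; rewrite !big_cons kM IH.
  rewrite -prodrXl -big_split /=; apply: eq_big_seq => p pl.
  rewrite k4_odd ?l_od // -exprM.
  rewrite -(quadratic_reciprocity (l_pr pl) (l_od pl) pq oq (nl _ pl)).
  rewrite mulrA (leg_sq (l_pr pl) (l_od pl)) ?mul1r // (dvdn_prime2 (l_pr pl) pq).
  exact: nl.
rewrite rec /chi /kappa.
have k4q : k4 q * k4 q = 1 by rewrite k4_odd // -expr2 sqrr_sign.
have k4N : k4 N = 1 \/ k4 N = -1.
  by rewrite k4_odd // -signr_odd; case: odd; [right | left].
case: b n_mod4 => [_|/(_ isT) N1].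
  rewrite leg2 // -k8_odd //; case: k4N => -> /=; first by rewrite expr1n; ring.
  by rewrite -k4_odd // -[LHS]mul1r -k4q; ring.
have -> : k4 N = 1 by rewrite k4_odd // -signr_odd (_ : odd N./2 = false) //; lia.
by rewrite leg1 // expr1n; ring.
Qed.

Lemma crt_one M p a : coprime p M -> (0 < p)%N -> (0 < M)%N ->
  exists g, (g = a %[mod p] /\ g = 1 %[mod M])%N.
Proof.
move=> pM p0 M0; exists (chinese p M a 1).
by split; [apply: chinese_modl | apply: chinese_modr].
Qed.

Lemma coprime_mod1 g M : (g = 1 %[mod M])%N -> coprime g M.
Proof. by move=> E; rewrite -coprime_modl E coprime_modl coprime1n. Qed.

(** By the Chinese remainder theorem, g is taken a nonresidue modulo p and 1 modulo Q / p. *)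
Lemma leg_independent p : p \in l -> exists g, [/\ coprime g Q, leg p g = -1 &
  forall p', p' \in l -> p' != p -> leg p' g = 1].
Proof.
move=> pl; have pp := l_pr pl; have op := l_od pl.
have [a la _] := nonresidue pp op.
pose M := (8 * \prod_(r <- rem p l) r)%N.
have pr : all prime (rem p l) by apply/allP => x /mem_rem /l_pr.
have QE : Q = (p * M)%N by rewrite /Q /N (perm_big _ (perm_to_rem pl)) big_cons /= /M; ring.
have M0 : (0 < M)%N by move: (ltnW Q_gt1); rewrite QE muln_gt0 => /andP[].
have cpM : coprime p M.
  rewrite /M coprimeMr coprime8 op /= prime_coprime // prime_dvd_prod //.
  by rewrite mem_rem_uniq // inE eqxx.
have [g [gp gM]] := crt_one a cpM (prime_gt0 pp) M0.
have lg : leg p g = -1 by rewrite (leg_mod pp gp).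
exists g; split=> // [|p' p'l p'p].
  rewrite QE coprimeMr (coprime_mod1 gM) andbT coprime_sym prime_coprime //.
  by rewrite -leg_eq0 // lg.
have p'M : (p' %| M)%N.
  by apply: dvdn_mull; rewrite prime_dvd_prod ?l_pr // mem_rem_uniq // inE p'p.
rewrite (@leg_mod p' (l_pr p'l) g 1) ?leg1 ?l_pr ?l_od //.
by rewrite -(modn_dvdm g p'M) gM modn_dvdm.
Qed.

(** Here g is 1 modulo N, and modulo 8 it is an odd class where [kappa] is -1. *)
Lemma chi_independent : exists g, [/\ coprime g Q, chi g = -1 &
  forall p, p \in l -> leg p g = 1].
Proof.
have [a oa ka] := kappa_nontrivial.
have c8N : coprime 8 N by rewrite coprime_sym coprime8.
have [g [g8 gN]] := crt_one a c8N isT N_gt0.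
have lg p : p \in l -> leg p g = 1.
  move=> pl; have pN : (p %| N)%N by rewrite prime_dvd_prod ?l_pr.
  rewrite (@leg_mod p (l_pr pl) g 1) ?leg1 ?l_pr ?l_od //.
  by rewrite -(modn_dvdm g pN) gN modn_dvdm.
exists g; split=> //.
  rewrite /Q coprimeMr (coprime_mod1 gN) andbT -coprime_modl g8 coprime_modl.
  by rewrite coprime8.
rewrite /chi [X in _ * X]big1_seq ?mulr1 => [|p /andP[_ /lg //]].
by case: kappa_char => _ _ kq _; rewrite -kq g8 kq.
Qed.

Let alpha (a : nat) : int := (coprime a Q)%:R.
Let A := dirichlet_conv alpha chi.

Lemma norm_form_split x y :
  coprime (x * x + n * (y * y)) Q -> split_by chi (x * x + n * (y * y)).
Proof.
move=> cm q pq qm.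
have cq : coprime q Q by apply: coprime_dvdl cm.
have c0 : chi q != 0 by rewrite chi_eq0 cq.
split=> // cN1.
move: cq; rewrite coprimeQ => /andP[oq /allP lq].
have ql : q \notin l by apply/negP => /lq; rewrite dvdnn.
apply: logn_norm_even => //; first by rewrite -chi_reciprocity.
rewrite lt0n; apply: contraTneq cm => ->.
by rewrite /coprime gcd0n; lia.
Qed.

Lemma sum_ge_size (f : nat -> int) (r s : seq nat) : uniq r -> uniq s -> {subset s <= r} ->
  (forall m, m \in r -> 0 <= f m) -> (forall m, m \in s -> 1 <= f m) ->
  (size s)%:R <= \sum_(m <- r) f m.
Proof.
move=> ur us sr f0 f1; rewrite (bigID (fun m => m \in s)) /= -[X in X <= _]addr0.
apply: lerD; last by rewrite big_seq_cond; apply: sumr_ge0 => m /andP[/f0].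
rewrite -big_filter (perm_big s).
  have -> : (size s)%:R = \sum_(m <- s) (1 : int).
    by rewrite big_const_seq count_predT iter_addr_0.
  apply: (@le_trans _ _ (\sum_(m <- s | m \in s) 1)); first by rewrite -big_seq.
  by rewrite [leRHS]big_seq; apply: ler_sum => m /f1.
by apply: uniq_perm; rewrite ?filter_uniq // => x; rewrite mem_filter andb_idr // => /sr.
Qed.

Lemma main_sum_large (C : nat) :
  exists R : nat, (C * R)%:R < \sum_(1 <= m < (R * R).+1) A m.
Proof.
have n0 : (0 < n)%N by rewrite /n muln_gt0 N_gt0; case: b.
(* The range of i starts at [I] = Y^2 to keep the values distinct, and [R] is such that all of them
   are at most R^2. *)
pose Y := (2 * n * C + 1)%N; pose I := (Y * Y)%N.
pose K := (C * (2 * n * I + 1 + 2 * n * Y) + 1)%N.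
pose R := (2 * n * (I + K) + 1 + 2 * n * Y)%N.
pose f := norm_family n.
pose s := [seq f i j | i <- iota I K, j <- iota 0 Y].
have fm i j : coprime (f i j) Q.
  have fE : f i j = (1 + n * (2 * (2 * n * i * i + 2 * i + 2 * j * j)))%N by rewrite /f /norm_family; ring.
  rewrite coprimeQ fE; apply/andP; split; first by lia.
  apply/allP => p pl; have pn : (p %| n)%N by apply: dvdn_mull; rewrite prime_dvd_prod ?l_pr.
  by rewrite (dvdn_addl _ (dvdn_mulr _ pn)) dvdn1; have := prime_gt1 (l_pr pl); lia.
have dec := dconv_split Q_gt1 chi_char chi_eq0.
have f_pos i j : (0 < f i j)%N by rewrite /f /norm_family; lia.
have us : uniq s.
  apply: allpairs_uniq; rewrite ?iota_uniq // => u v Hu Hv.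
  case/allpairsP: Hu => -[i j] [/=]; rewrite !mem_iota => ib jb ->.
  case/allpairsP: Hv => -[i' j'] [/=]; rewrite !mem_iota => ib' jb' -> /= E.
  have lt_f i1 j1 i2 j2 : (I <= i1)%N -> (i1 < i2)%N -> (j1 < Y)%N -> (f i1 j1 < f i2 j2)%N.
    exact: norm_family_lt.
  have ii : i = i'.
    by case: (ltngtP i i') => // lt; have := lt_f _ j _ j' _ lt; have := lt_f _ j' _ j _ lt; lia.
  rewrite -ii in E *; congr (_, _); move: E; rewrite /f /norm_family => /eqP.
  rewrite eqn_add2l eqn_pmul2l // !mulnn eqn_sqr; lia.
exists R; apply: (@lt_le_trans _ _ (size s)%:R).
  by rewrite ltr_nat size_allpairs !size_iota; apply: norm_family_count.
apply: sum_ge_size => //; first exact: iota_uniq.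
- move=> m /allpairsP[[i j] [/=]]; rewrite mem_index_iota !mem_iota => ib jb ->.
  by rewrite f_pos ltnS; apply: norm_family_le; lia.
- by move=> m; rewrite mem_index_iota => /andP[m0 _]; case: (dec m m0).
- move=> m /allpairsP[[i j] [_ _ ->]] /=.
  have [A0 /proj2 AE] := dec (f i j) (f_pos i j).
  by rewrite -gtz0_ge1 lt0r A0 andbT; exact/AE/norm_form_split/fm.
Qed.

(** Prescribing the sign (-1/p) makes -m a square modulo each odd prime p of n. *)
Theorem genus_exists : exists m, [/\ (0 < m)%N, split_by chi m &
  forall p, p \in l -> leg p m = leg p p.-1].
Proof.
apply: (exists_split_with_signs Q_gt1 chi_char chi_eq0 (psi := leg)
  (eps := fun p => leg p p.-1)) => //.
- exact: leg_charQ.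
- move=> p a pl; rewrite coprimeQ leg_eq0 ?l_pr // => /andP[_ /allP]; exact.
- move=> p pl; apply: leg_pm1; first exact: l_pr.
  by apply/negP => /dvdn_leq; have := prime_gt1 (l_pr pl); lia.
- exact: leg_independent.
- exact: chi_independent.
- exact: main_sum_large.
Qed.

(** The squarefree part [m1] of a genus element m works. Its primes q occur in m to an odd power, so
    [chi q = 1] and -n is a square modulo q; and m1 has the same symbol as m at the primes of
    [l]. *)
Theorem congruence_solution : exists m s c t, [/\ (0 < m)%N, coprime m n,
  (n %| t * t + m)%N & (m * c = s * s + n)%N].
Proof.
have [m [m0 sm lm]] := genus_exists.
have [t [s [ut pt mE]]] := squarefree_decomposition m0.
set m1 := (\prod_(p <- t) p)%N in mE.
have [m10 s0] : (0 < m1)%N /\ (0 < s)%N.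
  by move: m0; rewrite mE !muln_gt0 => /andP[-> /andP[->]].
have cop q : q \in t -> coprime q Q.
  move=> qt; have pq := allP pt _ qt.
  have qm : (q %| m)%N by rewrite mE dvdn_mulr // prime_dvd_prod.
  by have [+ _] := sm q pq qm; rewrite chi_eq0 negbK.
have tq q : q \in t -> exists x, (q %| x * x + n)%N.
  move=> qt; have pq := allP pt _ qt.
  have qm : (q %| m)%N by rewrite mE dvdn_mulr // prime_dvd_prod.
  have := cop q qt; rewrite coprimeQ => /andP[oq /allP lq].
  have ql : q \notin l by apply/negP => /lq; rewrite dvdnn.
  have [c0 cN1] := sm q pq qm.
  apply: leg_opp_sqr => //; rewrite -chi_reciprocity //.
  case: chi_char => _ _ _ /(_ q); rewrite !inE (negbTE c0) /= => /orP[/eqP//|/eqP/cN1].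
  by rewrite mE logn_squarefree_mul.
have [x /dvdnP[c xE]] := crt_sqr ut pt tq.
have [y yE] : exists y, (n %| y * y + m1)%N.
  have sub p : p \in l -> exists y, (p %| y * y + m1)%N.
    move=> pl; have [pp op] := (l_pr pl, l_od pl).
    have pN : ~~ (p %| p.-1)%N by apply/negP => /dvdn_leq; have := prime_gt1 pp; lia.
    apply: leg_opp_sqr => //; rewrite legM // -lm //.
    have : leg p m * leg p m = 1 by rewrite lm // leg_sq.
    rewrite mE legM // (legM pp op s s); have := leg_signs p s; have := leg_signs p m1.
    by rewrite !inE => /or3P[]/eqP-> /or3P[]/eqP->.
  rewrite /n; case: (b); last by rewrite mul1n; apply: crt_sqr.
  have nl2 : 2 \notin l by apply/negP => /l_od.
  have [||p|y] := @crt_sqr (2 :: l) m1; first by rewrite /= nl2.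
  - by rewrite /= l_prime.
  (* At the prime 2 the root is [m1] itself, m1^2 + m1 being even. *)
  - rewrite inE => /predU1P[->|/sub //]; exists m1; rewrite dvdn2 oddD oddM; by case: odd.
  - by rewrite big_cons; exists y.
exists m1, x, c, y; split=> //; last by rewrite mulnC xE.
rewrite coprime_sym coprime_prod_primes //; apply/allP => q qt; have := cop q qt.
rewrite coprimeQ -prime_coprime ?(allP pt) // /n coprimeMr coprime_prod_primes //.
by case/andP => oq ->; case: (b); rewrite ?coprimen1 // coprimen2 oq.
Qed.

End GenusCharacters.

(** * Three squares and octagonal numbers *)

Theorem three_squares (n : nat) : (n %% 4 = 1)%N \/ (n %% 4 = 2)%N ->
  exists x y z : Z, Z.of_nat n = x * x + y * y + z * z.
Proof.
move=> n4; have n0 : (0 < n)%N by lia.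
have [t [s [ut pt nE]]] := squarefree_decomposition n0.
pose b := 2%N \in t; pose l := rem 2%N t; set n1 := (\prod_(p <- t) p)%N in nE.
have n1E : n1 = ((if b then 2 else 1) * \prod_(p <- l) p)%N.
  rewrite /n1 /b /l; case: ifP => bt; first by rewrite (perm_big _ (perm_to_rem bt)) big_cons.
  by rewrite mul1n rem_id // bt.
have l_odd : all (fun p => prime p && odd p) l.
  apply/allP => p; rewrite /l mem_rem_uniq // inE => /andP[p2 /(allP pt) pp].
  by rewrite pp; case: (even_prime pp) => // p2'; rewrite p2' in p2.
have odd_l : odd (\prod_(p <- l) p)%N.
  elim: (l) l_odd => [|p u IH] /=; first by rewrite big_nil.
  by case/andP => /andP[_ op] pu; rewrite big_cons oddM op IH.
(* As 4 does not divide n, [s] is odd and its square is 1 modulo 4. *)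
have n14 : (n1 %% 4 = n %% 4)%N.
  have os : odd s by apply: contraTT isT => es; have /dvdnP[k sE] : (2 %| s)%N by [rewrite dvdn2]; subst s; lia.
  have sE : (s * s = 4 * (s./2 * s./2 + s./2) + 1)%N.
    by rewrite -{1 2}(odd_double_half s) os; lia.
  by rewrite nE sE; lia.
have l4 : ~~ b -> (\prod_(p <- l) p %% 4 = 1)%N.
  by move/negbTE => bF; move: n1E; rewrite bF mul1n => E; rewrite E in n14; lia.
have [m [k [c [r [m0 cop /dvdnP[v vE] kE]]]]] := congruence_solution (rem_uniq 2%N ut) l_odd l4.
rewrite -/l -n1E in cop vE kE.
(* Bezout over the natural numbers reads i m - j n1 = 1, hence the sign in [- Z.of_nat j]. *)
have [[i j] /= ij] := coprimeP _ m0 cop.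
have n10 : (0 < n1)%N by lia.
have [||||| x [y [z E]]] :=
  @three_squares_of_congruences (Z.of_nat n1) (Z.of_nat m) (Z.of_nat k) (Z.of_nat c)
    (Z.of_nat r) (Z.of_nat v) (Z.of_nat i) (- Z.of_nat j); try lia.
exists (Z.of_nat s * x), (Z.of_nat s * y), (Z.of_nat s * z).
rewrite nE !Nat2Z.inj_mul E; lia.
Qed.

Lemma three_squares_Z (k r : Z) : 0 <= k -> r = 1 \/ r = 2 ->
  exists x y z : Z, 4 * k + r = x * x + y * y + z * z.
Proof.
move=> k0 r12; have [|x [y [z E]]] := @three_squares (Z.to_nat (4 * k + r)); first by lia.
by exists x, y, z; rewrite -E; lia.
Qed.

Ltac Zify.zify_post_hook ::= Z.to_euclidean_division_equations.

(** * From squares prime to 3 to octagonal numbers *)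

Lemma square_mod3 (x : Z) :
  x mod 3 = 0 /\ (x * x) mod 3 = 0 \/ x mod 3 <> 0 /\ (x * x) mod 3 = 1.
Proof.
have E := Z.div_mod x 3 ltac:(lia); have B := Z.mod_pos_bound x 3 ltac:(lia).
have : x * x = (x mod 3) * (x mod 3) + (3 * (x / 3) * (x / 3) + 2 * (x / 3) * (x mod 3)) * 3 by nia.
move=> ->; rewrite Z_mod_plus_full.
have [-> | [-> | ->]] : x mod 3 = 0 \/ x mod 3 = 1 \/ x mod 3 = 2 by lia.
all: by [left | right].
Qed.

Lemma octagonal_square (X : Z) : X mod 3 <> 0 -> exists x : Z, 3 * P8 x + 1 = X * X.
Proof.
move=> X3; have [X1 | X2] : X mod 3 = 1 \/ X mod 3 = 2 by lia.
  exists ((1 - X) / 3); have : X = 1 - 3 * ((1 - X) / 3) by lia.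
  by rewrite /P8; move: ((1 - X) / 3) => x ->; lia.
exists ((X + 1) / 3); have : X = 3 * ((X + 1) / 3) - 1 by lia.
by rewrite /P8; move: ((X + 1) / 3) => x ->; lia.
Qed.

(** Multiplication of u + v sqrt(-2) by 1 - sqrt(-2) or its conjugate, of norm 3. In each choice z
    and t agree modulo 3, up to sign, and u - v, u + v are not both divisible by 3, since their
    difference is 2 v. *)
Lemma prime_to_3_form (u v : Z) : v mod 3 <> 0 ->
  exists z t : Z, z mod 3 <> 0 /\ t mod 3 <> 0 /\ z * z + 2 * (t * t) = 3 * (u * u + 2 * (v * v)).
Proof.
move=> v3; have [uv | uv] : (u - v) mod 3 <> 0 \/ (u + v) mod 3 <> 0 by lia.
  by exists (u + 2 * v), (u - v); split; [lia | split; lia].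
by exists (u - 2 * v), (u + v); split; [lia | split; lia].
Qed.

Lemma octagonal_of_squares (n x y z v : Z) : v mod 3 <> 0 ->
  3 * n + 11 = x * x + y * y + z * z + 18 * (v * v) ->
  exists x y z t : Z, P8 x + P8 y + 3 * P8 z + 6 * P8 t = n.
Proof.
move=> v3.
have main a b c : a mod 3 <> 0 -> b mod 3 <> 0 -> c mod 3 = 0 ->
    3 * n + 11 = a * a + b * b + c * c + 18 * (v * v) ->
    exists x y z t : Z, P8 x + P8 y + 3 * P8 z + 6 * P8 t = n.
  move=> a3 b3 c3 E; have cE : c = 3 * (c / 3) by lia.
  have [z' [t' [z3 [t3 zt]]]] := prime_to_3_form (c / 3) v3.
  have [p pE] := octagonal_square a3; have [q qE] := octagonal_square b3.
  have [r rE] := octagonal_square z3; have [s sE] := octagonal_square t3.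
  (* The constant 11 is 1 + 1 + 3 + 6, the units of the four relations 3 P8 + 1 = X^2 with their
     coefficients. *)
  exists p, q, r, s; rewrite cE in E; lia.
move=> E; have X := square_mod3 x; have Y := square_mod3 y; have Z := square_mod3 z.
case: X Y Z => [] [x3 xx] [] [y3 yy] [] [z3 zz].
all: try by exfalso; lia.
- apply: (main y z x) => //; lia.
- apply: (main x z y) => //; lia.
- apply: (main x y z) => //; lia.
Qed.

(** The range in which 3 n + 11 - 18 * 2^2 is negative, settled by a search over arguments of
    absolute value at most 2. *)
Lemma octagonal_small (n : Z) : 0 <= n <= 20 ->
  exists x y z t : Z, P8 x + P8 y + 3 * P8 z + 6 * P8 t = n.
Proof.
pose D := [0; 1; -1; 2; -2].
pose ok k (w : Z * Z * (Z * Z)) := let '(x, y, (z, t)) := w in P8 x + P8 y + 3 * P8 z + 6 * P8 t =? Z.of_nat k.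
have /forallb_forall H : List.forallb (fun k => List.existsb (ok k) (list_prod (list_prod D D) (list_prod D D)))
  (List.seq 0 21) = true by vm_compute.
move=> n20; have /existsb_exists [[[x y] [z t]] [_ /Z.eqb_eq E]] := H (Z.to_nat n) ltac:(apply/in_seq; lia).
by exists x, y, z, t; rewrite E; lia.
Qed.

Theorem theorem2p2 :
  (forall n : Z, 0 <= n ->
     exists x y z t : Z, P8 x + P8 y + 3 * P8 z + 6 * P8 t = n)
  /\ universal [1; 1; 3; 6]%positive.
Proof.
have main n : 0 <= n -> exists x y z t : Z, P8 x + P8 y + 3 * P8 z + 6 * P8 t = n.
  move=> n0; have [n20 | n20] := Z_le_gt_dec n 20; first exact: octagonal_small.
  have [v [v3 [vpos v4]]] : exists v : Z, v mod 3 <> 0 /\ 0 < 3 * n + 11 - 18 * (v * v) /\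
      ((3 * n + 11 - 18 * (v * v)) mod 4 = 1 \/ (3 * n + 11 - 18 * (v * v)) mod 4 = 2).
    (* Modulo 4, 18 v^2 is 0 for v = 2 and 2 for v = 1: the first keeps the residues 1 and 2, the
       second sends 0 and 3 to 2 and 1. *)
    have [r | r] : ((3 * n + 11) mod 4 = 1 \/ (3 * n + 11) mod 4 = 2) \/
                   ((3 * n + 11) mod 4 = 0 \/ (3 * n + 11) mod 4 = 3) by lia.
    - by exists 2; lia.
    - by exists 1; lia.
  set w := 3 * n + 11 - 18 * (v * v) in vpos v4.
  have [||x [y [z E]]] := @three_squares_Z (w / 4) (w mod 4); [by lia | by lia | ].
  rewrite -Z.div_mod // in E.
  by apply: (@octagonal_of_squares n x y z v) => //; lia.
split=> // n /main [x [y [z [t E]]]].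
by exists [x; y; z; t]; split=> //; rewrite -E; cbv [Phi List.fold_right List.map List.combine]; lia.
Qed.
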